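(* There are absolute constants $C_4 > 0$ and $c > 0$ with the following property. Let $m,n$ be positive integers, let $K > 0$ be a real number, and suppose that $f : \mathbf{F}_2^m \to \mathbf{F}_2^n$ is a function such that, if $x,y$ are selected independently and uniformly at random from $\mathbf{F}_2^m$, then $\mathbf{P}(f(x+y) = f(x)+f(y)) \geq 1/K$. Then there is a homomorphism $g : \mathbf{F}_2^m \to \mathbf{F}_2^n$ such that, for $x$ selected uniformly at random from $\mathbf{F}_2^m$, $\mathbf{P}(f(x) = g(x)) \geq c K^{-C_4}$.
   Context: $\mathbf{F}_2$ is the field with two elements. The constants $c, C_4$ do not depend on $m,n,K,f$. *)

(* Defs.v *)
From mathcomp Require Import all_boot all_order all_algebra.
From mathcomp Require Import reals.

Set Implicit Arguments.
Unset Strict Implicit.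
Unset Printing Implicit Defensive.

Import Order.TTheory GRing.Theory Num.Theory.
Local Open Scope ring_scope.

(* The probability of the event P under the uniform distribution on T.  For
   T := T1 * T2 the two coordinates are independent and uniform. *)
Definition unif_prob (R : realType) (T : finType) (P : pred T) : R :=
  #|[set x | P x]|%:R / #|T|%:R.

(* Main.v *)
From HB Require Import structures.
Require Import Defs.
From mathcomp Require Import all_boot all_order all_algebra.
From mathcomp Require Import boolp classical_sets reals topology.
From mathcomp Require Import normedtype exp derive.
From mathcomp Require Import ring lra.

Set Implicit Arguments.
Unset Strict Implicit.
Unset Printing Implicit Defensive.

Import Order.TTheory GRing.Theory Num.Theory.
Import numFieldNormedType.Exports.
Local Open Scope ring_scope.

(* The hypothesis says that the graph Gam of f contains many triples a, b, a + b.  By an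
   entropic Balog-Szemeredi-Gowers argument, conditioning (a, b) on a + b gives laws p0, q0 on
   Gam of nearly full entropy and of Ruzsa distance O(ln K).

   The core is the entropy proof of Marton's conjecture (Gowers, Green, Manners, Tao).  Let
   (p1, p2) minimize rdist p1 p2 + eta (rdist p0 p1 + rdist q0 p2), where rdist is the Ruzsa
   distance; it exists by compactness.  Let k = rdist p1 p2.  By the triangle inequality, no
   pair at distance O(k) from (p1, p2) can have distance less than k - O(eta k).  For
   independent X1, X3 distributed as p1 and X2, X4 distributed as p2, the
   fibring identity then shows that any two of U = X1 + X2, V = X3 + X2 and U + V = X1 + X3
   have mutual information O(eta k) given X1 + X2 + X3 + X4.  Applying Balog-Szemeredi-Gowers
   to U and V produces pairs of distance O(eta k), so k = 0 when eta is small.  Distance zero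
   forces p1 to be uniform on a coset of a subgroup H, and comparison with (p0, q0) itself gives
   rdist p0 p1 = O(rdist p0 q0).

   Hence |H| is at most a power of K times |Gam|, and a coset of H contains at least a power of
   1/K of Gam.  A linear section of the first projection of H agrees with f, up to an additive
   constant, on a large set; multiplying the constant by a suitable linear functional makes the
   affine map linear. *)

(** * Shannon entropy on a finite weighted space *)

Section Entropy.
Variable R : realType.

Definition law (O : finType) (T : eqType) (mu : O -> R) (X : O -> T) (t : T) : R :=
  \sum_(w | X w == t) mu w.

Definition prob (O : finType) (mu : O -> R) := (forall w, 0 <= mu w) /\ \sum_w mu w = 1.

(* The expectation of [- ln (law mu X)] at X; outcomes of weight zero contribute nothing. *)
Definition ent (O : finType) (T : eqType) (mu : O -> R) (X : O -> T) : R :=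
  - \sum_w mu w * ln (law mu X (X w)).

Section Law.
Variables (O : finType) (mu : O -> R).
Hypothesis mu_prob : prob mu.

Let mu_ge0 w : 0 <= mu w. Proof. exact: mu_prob.1. Qed.

Lemma law_ge0 (T : eqType) (X : O -> T) t : 0 <= law mu X t.
Proof. by apply: sumr_ge0 => w _. Qed.

Lemma law_gt0 (T : eqType) (X : O -> T) w : 0 < mu w -> 0 < law mu X (X w).
Proof.
move=> mw; rewrite /law (bigD1 w) //=; apply: ltr_wpDr => //.
by apply: sumr_ge0.
Qed.

Lemma law_gt0_ex (T : eqType) (X : O -> T) t :
  0 < law mu X t -> exists2 w, X w = t & 0 < mu w.
Proof.
move=> h; case: (pickP (fun w => (X w == t) && (0 < mu w))) => [w /andP[/eqP e p]|none].
  by exists w.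
suff e0 : law mu X t = 0 by rewrite e0 ltxx in h.
apply: big1 => w Xw; apply/eqP; rewrite eq_le mu_ge0 andbT leNgt.
by have := none w; rewrite Xw /= => ->.
Qed.

Lemma sum_law (T : finType) (X : O -> T) (g : T -> R) :
  \sum_w mu w * g (X w) = \sum_t law mu X t * g t.
Proof.
rewrite (partition_big X predT) //=; apply: eq_bigr => t _.
by rewrite big_distrl /=; apply: eq_bigr => w /eqP ->.
Qed.

Lemma law_prob (T : finType) (X : O -> T) : prob (law mu X).
Proof.
split=> [t|]; first exact: law_ge0.
under eq_bigr => t _ do rewrite -[law _ _ _]mulr1.
rewrite -(sum_law X (fun=> 1)); under eq_bigr do rewrite mulr1.
exact: mu_prob.2.
Qed.

Lemma law_fst (A C : finType) (X : O -> A) (Z : O -> C) c :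
  \sum_a law mu (fun w => (X w, Z w)) (a, c) = law mu Z c.
Proof.
rewrite /law [RHS](partition_big X predT) //=; apply: eq_bigr => a _.
by apply: eq_bigl => w; rewrite xpair_eqE andbC.
Qed.

Lemma law_snd (A C : finType) (X : O -> A) (Z : O -> C) a :
  \sum_c law mu (fun w => (X w, Z w)) (a, c) = law mu X a.
Proof.
by rewrite /law [RHS](partition_big Z predT).
Qed.

Lemma law_comp (A B : finType) (X : O -> A) (f : A -> B) b :
  law mu (f \o X) b = \sum_(a | f a == b) law mu X a.
Proof.
rewrite /law [LHS](partition_big X (fun a => f a == b)) //=.
apply: eq_bigr => a /eqP fa; apply: eq_bigl => w.
by case: (X w =P a) => [->|_]; rewrite ?andbF // fa eqxx.
Qed.

Lemma entE (T : finType) (X : O -> T) : ent mu X = - \sum_t law mu X t * ln (law mu X t).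
Proof. by rewrite /ent (sum_law X (fun t => ln (law mu X t))). Qed.

Lemma eq_mu_sum (F G : O -> R) : (forall w, 0 < mu w -> F w = G w) ->
  \sum_w mu w * F w = \sum_w mu w * G w.
Proof.
move=> e; apply: eq_bigr => w _; have := mu_ge0 w.
by rewrite le_eqVlt => /orP[/eqP <-|/e ->]; rewrite ?mul0r.
Qed.

(** Up to outcomes of weight zero, the events [X = X w] and [Y = Y w] coincide whenever [w] has
    positive weight. Most changes of variables below go through this lemma. *)
Lemma ent_determined (S T : finType) (X : O -> S) (Y : O -> T) f g :
  (forall w, 0 < mu w -> Y w = f (X w)) -> (forall w, 0 < mu w -> X w = g (Y w)) ->
  ent mu X = ent mu Y.
Proof.
move=> XY YX; congr (- _); apply: eq_mu_sum => w mw; congr (ln _).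
rewrite /law big_mkcond [RHS]big_mkcond; apply: eq_bigr => v _.
have := mu_ge0 v; rewrite le_eqVlt => /orP[/eqP <-|mv]; first by rewrite !if_same.
by rewrite (_ : (X v == X w) = (Y v == Y w)) //; apply/eqP/eqP => e;
  [rewrite !XY // e | rewrite !YX // e].
Qed.

Lemma ent_ext (T : eqType) (X Y : O -> T) : X =1 Y -> ent mu X = ent mu Y.
Proof.
move=> e; congr (- _); apply: eq_bigr => w _; congr (_ * ln _).
by apply: eq_bigl => w'; rewrite !e.
Qed.

(** Strict concavity of the logarithm: [ln r < r - 1] for [r = q / p] unless [r = 1]. *)
Lemma ln_gap (p q : R) : 0 < p -> 0 < q ->
  p * (ln q - ln p) <= q - p /\ (q - p <= p * (ln q - ln p) -> q = p).
Proof.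
move=> p0 q0; rewrite -ln_div ?posrE //.
have r0 : 0 < q / p by rewrite divr_gt0.
have qE : q = p * (q / p) by rewrite mulrCA divff ?mulr1 // gt_eqF.
move: (q / p) r0 qE => r r0 ->; rewrite -[X in _ - X]mulr1 -mulrBr.
have [->|r1] := eqVneq r 1; first by rewrite ln1 subrr mulr0 mulr1.
suff lt : p * ln r < p * (r - 1) by split; [exact: ltW | rewrite leNgt lt].
have := @expR_gt1Dx R (ln r); rewrite lnK ?posrE // => H.
by rewrite ltr_pM2l // ltrBrDl; apply: H; rewrite ln_eq0.
Qed.

(** The right side exceeds the left by at least a sum of nonnegative gaps from [ln_gap]; equality
    makes every gap vanish. Positivity of [q] on the support matters because [ln 0] is 0 here, not
    minus infinity. *)
Lemma gibbs_with_equality (T : finType) (X : O -> T) (q : T -> R) :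
  (forall t, 0 <= q t) -> \sum_t q t <= 1 -> (forall t, 0 < law mu X t -> 0 < q t) ->
  ent mu X <= - \sum_w mu w * ln (q (X w)) /\
  (- \sum_w mu w * ln (q (X w)) <= ent mu X -> forall t, 0 < law mu X t -> q t = law mu X t).
Proof.
move=> q0 q1 qp; rewrite entE (sum_law X (fun t => ln (q t))).
set p := law mu X in qp *.
have p0 t : 0 <= p t by exact: law_ge0.
have p1 : \sum_t p t = 1 by case: (law_prob X).
pose gap t := (q t - p t) - p t * (ln (q t) - ln (p t)).
have gap0 t : 0 <= gap t.
  rewrite /gap subr_ge0; have := p0 t; rewrite le_eqVlt => /orP[/eqP <-|pt].
    by rewrite mul0r subr0.
  by case: (ln_gap pt (qp _ pt)).
have gapS : \sum_t gap t = \sum_t q t - 1 - (\sum_t p t * ln (q t) - \sum_t p t * ln (p t)).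
  rewrite /gap !sumrB p1; congr (_ - _); rewrite -sumrB.
  by apply: eq_bigr => t _; rewrite mulrBr.
have S0 : 0 <= \sum_t gap t by apply: sumr_ge0.
split; first by move: S0; rewrite gapS; lra.
move=> le t pt.
have S00 : \sum_t gap t = 0 by move: S0; rewrite gapS; lra.
have := psumr_eq0P (fun t _ => gap0 t) S00 isT (i := t).
have [_ h] := ln_gap pt (qp _ pt); rewrite /gap => e; apply: h; lra.
Qed.

Lemma gibbs (T : finType) (X : O -> T) (q : T -> R) :
  (forall t, 0 <= q t) -> \sum_t q t <= 1 -> (forall t, 0 < law mu X t -> 0 < q t) ->
  ent mu X <= - \sum_w mu w * ln (q (X w)).
Proof. by move=> a b c; case: (gibbs_with_equality a b c). Qed.

Lemma law_pair_le (A C : finType) (X : O -> A) (Z : O -> C) w :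
  law mu (fun w => (X w, Z w)) (X w, Z w) <= law mu X (X w).
Proof.
rewrite -(law_snd X Z) (bigD1 (Z w)) //= lerDl; apply: sumr_ge0 => *; exact: law_ge0.
Qed.

(* Gibbs' inequality for the law making X and Y conditionally independent given Z. *)
Lemma ent_submod (A B C : finType) (X : O -> A) (Y : O -> B) (Z : O -> C) :
  ent mu (fun w => (X w, Y w, Z w)) + ent mu Z <=
  ent mu (fun w => (X w, Z w)) + ent mu (fun w => (Y w, Z w)).
Proof.
pose pxz := law mu (fun w => (X w, Z w)); pose pyz := law mu (fun w => (Y w, Z w)).
pose pz := law mu Z.
pose q (t : A * B * C) := pxz (t.1.1, t.2) * pyz (t.1.2, t.2) / pz t.2.
have q0 t : 0 <= q t by rewrite /q divr_ge0 ?mulr_ge0 //; exact: law_ge0.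
have q1 : \sum_t q t <= 1.
  have <- : \sum_c pz c = 1 by case: (law_prob Z).
  rewrite (eq_bigr (fun t : A * B * C => q (t.1, t.2))); last by case.
  rewrite -(pair_bigA _ (fun ab c => q (ab, c))) /= exchange_big /=.
  apply: ler_sum => c _.
  rewrite (eq_bigr (fun t : A * B => q ((t.1, t.2), c))); last by case.
  rewrite -(pair_bigA _ (fun a b => q ((a, b), c))) /= /q /=.
  under eq_bigr => a _ do rewrite -mulr_suml -mulr_sumr.
  rewrite -mulr_suml -mulr_suml.
  rewrite /pxz /pyz law_fst law_fst -/pz.
  have [->|nz] := eqVneq (pz c) 0; first by rewrite !mul0r.
  by rewrite -mulrA divff // mulr1.
have qp t : 0 < law mu (fun w => (X w, Y w, Z w)) t -> 0 < q t.
  case/law_gt0_ex => w <- mw; rewrite /q /=.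
  by rewrite divr_gt0 ?mulr_gt0 //; [exact: (law_gt0 (fun w => (X w, Z w)))
    |exact: (law_gt0 (fun w => (Y w, Z w)))|exact: law_gt0].
apply: (@le_trans _ _ (- \sum_w mu w * ln (q (X w, Y w, Z w)) + ent mu Z)).
  by rewrite lerD2r; exact: gibbs.
rewrite (eq_mu_sum (G := fun w => ln (pxz (X w, Z w)) + ln (pyz (Y w, Z w)) - ln (pz (Z w)))).
  rewrite /ent -/pxz -/pyz -/pz.
  rewrite -!opprD lerN2 -!big_split /=; apply: ler_sum => w _.
  by rewrite -!mulrDr subrK.
move=> w mw; have hx := law_gt0 (fun w => (X w, Z w)) mw.
have hy := law_gt0 (fun w => (Y w, Z w)) mw; have hz := law_gt0 Z mw.
by rewrite /q ln_div ?posrE ?mulr_gt0 // lnM ?posrE.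
Qed.

Lemma ent_cst (T : finType) (t : T) : ent mu (fun=> t) = 0.
Proof.
rewrite /ent /law eqxx mu_prob.2 ln1 big1 ?oppr0 // => w _.
by rewrite mulr0.
Qed.

(** Submodularity over a constant variable. *)
Lemma ent_subadd (A B : finType) (X : O -> A) (Y : O -> B) :
  ent mu (fun w => (X w, Y w)) <= ent mu X + ent mu Y.
Proof.
have := ent_submod X Y (fun=> tt); rewrite ent_cst addr0.
rewrite (@ent_determined _ _ (fun w => (X w, Y w, tt)) (fun w => (X w, Y w))
  (fun t => t.1) (fun t => (t, tt))) //.
rewrite (@ent_determined _ _ (fun w => (X w, tt)) X (fun t => t.1) (fun t => (t, tt))) //.
by rewrite (@ent_determined _ _ (fun w => (Y w, tt)) Y (fun t => t.1) (fun t => (t, tt))).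
Qed.

(** Gibbs' inequality against the subprobability that draws [b] from the law of [Y] and gives weight
    [1 / M] to each point of [N b]. *)
Lemma ent_cond_card (A B : finType) (X : O -> A) (Y : O -> B) (N : B -> {set A}) (M : R) :
  (forall w, 0 < mu w -> X w \in N (Y w)) -> (forall b, #|N b|%:R <= M) -> 0 < M ->
  ent mu (fun w => (X w, Y w)) - ent mu Y <= ln M.
Proof.
move=> XN NM M0.
pose q (t : A * B) := if t.1 \in N t.2 then law mu Y t.2 / M else 0.
have q0 t : 0 <= q t by rewrite /q; case: ifP => // _; rewrite divr_ge0 ?law_ge0 // ltW.
have q1 : \sum_t q t <= 1.
  have <- : \sum_b law mu Y b = 1 by case: (law_prob Y).
  rewrite (eq_bigr (fun t : A * B => q (t.1, t.2))); last by case.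
  rewrite -(pair_bigA _ (fun a b => q (a, b))) /= exchange_big /=.
  apply: ler_sum => b _; rewrite /q /= -big_mkcond /= sumr_const.
  rewrite -mulr_natr mulrAC ler_pdivrMr // ler_wpM2l ?law_ge0 //.
have qp t : 0 < law mu (fun w => (X w, Y w)) t -> 0 < q t.
  case/law_gt0_ex => w <- mw; rewrite /q /= XN // divr_gt0 //; exact: law_gt0.
have := gibbs q0 q1 qp.
rewrite (eq_mu_sum (G := fun w => ln (law mu Y (Y w)) - ln M)).
  under eq_bigr do rewrite mulrBr.
  rewrite sumrB -mulr_suml mu_prob.2 /ent; lra.
move=> w mw; rewrite /q /= XN // ln_div ?posrE //; exact: law_gt0.
Qed.

Lemma ent_card (A : finType) (X : O -> A) (N : {set A}) :
  (forall w, 0 < mu w -> X w \in N) -> (0 < #|N|)%N -> ent mu X <= ln #|N|%:R.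
Proof.
move=> XN N0.
have := @ent_cond_card _ _ X (fun=> tt) (fun=> N) #|N|%:R XN (fun=> lexx _).
rewrite ltr0n ent_cst subr0 => /(_ N0).
by rewrite (@ent_determined _ _ (fun w => (X w, tt)) X (fun t => t.1) (fun t => (t, tt))).
Qed.

End Law.

Lemma ent_push (O O' T : finType) (mu : O -> R) (phi : O -> O') (X : O' -> T) :
  ent (law mu phi) X = ent mu (X \o phi).
Proof.
have lawE t : law (law mu phi) X t = law mu (X \o phi) t by rewrite law_comp.
rewrite /ent; congr (- _).
rewrite -(sum_law mu phi (fun w' => ln (law (law mu phi) X (X w')))).
by apply: eq_bigr => w _; rewrite lawE.
Qed.

Lemma eq_ent (O T : finType) (mu nu : O -> R) (X : O -> T) : mu =1 nu -> ent mu X = ent nu X.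
Proof.
move=> e; rewrite /ent; congr (- _); apply: eq_bigr => w _; rewrite e; congr (_ * ln _).
by apply: eq_bigr => w' _; rewrite e.
Qed.

End Entropy.

(** * Independence and conditioning *)

Section Independence.
Variable R : realType.

Definition indep (O A B : finType) (mu : O -> R) (X : O -> A) (Y : O -> B) :=
  forall a b, law mu (fun w => (X w, Y w)) (a, b) = law mu X a * law mu Y b.

(** Denominators are cleared, so for a probability [mu] a value [c] of probability zero imposes no
    condition. *)
Definition cindep (O A B C : finType) (mu : O -> R) (X : O -> A) (Y : O -> B) (Z : O -> C) :=
  forall a b c, law mu (fun w => (X w, Y w, Z w)) (a, b, c) * law mu Z c =
    law mu (fun w => (X w, Z w)) (a, c) * law mu (fun w => (Y w, Z w)) (b, c).

Definition cond (O C : finType) (mu : O -> R) (Z : O -> C) (c : C) (w : O) : R :=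
  if Z w == c then mu w / law mu Z c else 0.

(* Two copies of the space, independent conditionally on a common value of Z.  Here, as in
   [cond], a value of probability zero is harmless because [x / 0 = 0]. *)
Definition cond_copies (O C : finType) (mu : O -> R) (Z : O -> C) (w : O * O) : R :=
  if Z w.1 == Z w.2 then mu w.1 * mu w.2 / law mu Z (Z w.1) else 0.

Definition prodm (A B : finType) (p : A -> R) (q : B -> R) (w : A * B) : R := p w.1 * q w.2.

Lemma prodm_prob (A B : finType) (p : A -> R) (q : B -> R) :
  prob p -> prob q -> prob (prodm p q).
Proof.
move=> [p0 p1] [q0 q1]; split=> [w|]; first exact: mulr_ge0.
rewrite -(pair_bigA _ (fun a b => p a * q b)) /=.
by under eq_bigr do rewrite -mulr_sumr q1 mulr1.
Qed.

Section Fixed.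
Variables (O : finType) (mu : O -> R).
Hypothesis mu_prob : prob mu.

Lemma indepC (A B : finType) (X : O -> A) (Y : O -> B) : indep mu X Y -> indep mu Y X.
Proof.
move=> i b a; rewrite mulrC -i /law; apply: eq_bigl => w.
by rewrite !xpair_eqE andbC.
Qed.

Lemma indep_comp (A B A' B' : finType) (X : O -> A) (Y : O -> B) (f : A -> A') (g : B -> B') :
  indep mu X Y -> indep mu (fun w => f (X w)) (fun w => g (Y w)).
Proof.
move=> i a b.
rewrite (law_comp mu X f) (law_comp mu Y g) big_distrlr /=.
rewrite (law_comp mu (fun w => (X w, Y w)) (fun t => (f t.1, g t.2))) pair_big /=.
by apply: eq_big => [] [x y] //= _; rewrite i.
Qed.

Lemma indep_ent (A B : finType) (X : O -> A) (Y : O -> B) :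
  indep mu X Y -> ent mu (fun w => (X w, Y w)) = ent mu X + ent mu Y.
Proof.
move=> i; rewrite /ent -opprD -big_split /=; congr (- _).
under [RHS]eq_bigr do rewrite -mulrDr.
apply: (eq_mu_sum mu_prob) => w mw.
by rewrite i lnM // posrE; exact: (law_gt0 mu_prob).
Qed.

Lemma cindep_ent (A B C : finType) (X : O -> A) (Y : O -> B) (Z : O -> C) :
  cindep mu X Y Z ->
  ent mu (fun w => (X w, Y w, Z w)) + ent mu Z =
  ent mu (fun w => (X w, Z w)) + ent mu (fun w => (Y w, Z w)).
Proof.
move=> i; rewrite /ent -!opprD -!big_split /=; congr (- _).
under eq_bigr do rewrite -mulrDr.
under [RHS]eq_bigr do rewrite -mulrDr.
apply: (eq_mu_sum mu_prob) => w mw.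
rewrite -!lnM ?posrE ?i //.
- exact: (law_gt0 mu_prob (fun w => (X w, Z w))).
- exact: (law_gt0 mu_prob (fun w => (Y w, Z w))).
- exact: (law_gt0 mu_prob (fun w => (X w, Y w, Z w))).
- exact: (law_gt0 mu_prob).
Qed.

(** Every law involved factors through those of the two independent pairs. In [fibring], [Z] and [W]
    are sums involving [X] and [Y] respectively. *)
Lemma indep_cindep (A B C D : finType) (X : O -> A) (Y : O -> B) (Z : O -> C) (W : O -> D) :
  indep mu (fun w => (X w, Z w)) (fun w => (Y w, W w)) ->
  cindep mu X Y (fun w => (Z w, W w)).
Proof.
move=> i a b [c d].
have e1 : law mu (fun w => (X w, Y w, (Z w, W w))) (a, b, (c, d)) =
          law mu (fun w => (X w, Z w, (Y w, W w))) (a, c, (b, d)).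
  by apply: eq_bigl => w; rewrite !xpair_eqE andbACA.
have e2 := indep_comp (fun t : A * C => t.2) (fun t : B * D => t.2) i c d.
have e3 : law mu (fun w => (X w, (Z w, W w))) (a, (c, d)) =
          law mu (fun w => (X w, Z w, W w)) (a, c, d).
  by apply: eq_bigl => w; rewrite !xpair_eqE andbA.
have e3' := indep_comp (fun t : A * C => t) (fun t : B * D => t.2) i (a, c) d.
have e4 : law mu (fun w => (Y w, (Z w, W w))) (b, (c, d)) =
          law mu (fun w => (Z w, (Y w, W w))) (c, (b, d)).
  by apply: eq_bigl => w; rewrite !xpair_eqE andbCA.
have e4' := indep_comp (fun t : A * C => t.2) (fun t : B * D => t) i c (b, d).
rewrite e1 i e2 e3 e4; rewrite /= in e3' e4'.
have -> : law mu (fun w => (X w, Z w, W w)) (a, c, d) =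
  law mu (fun w => (X w, Z w)) (a, c) * law mu W d.
  by rewrite -e3'; apply: eq_bigl => w.
have -> : law mu (fun w => (Z w, (Y w, W w))) (c, (b, d)) =
  law mu Z c * law mu (fun w => (Y w, W w)) (b, d).
  by rewrite -e4'; apply: eq_bigl => w.
ring.
Qed.

Lemma cond_prob (C : finType) (Z : O -> C) c : 0 < law mu Z c -> prob (cond mu Z c).
Proof.
move=> h; split=> [w|].
  by rewrite /cond; case: ifP => // _; rewrite divr_ge0 ?(ltW h) //; apply: mu_prob.1.
by rewrite -big_mkcond /= -mulr_suml divff // gt_eqF.
Qed.

Lemma law_cond (A C : finType) (X : O -> A) (Z : O -> C) a c :
  law (cond mu Z c) X a = law mu (fun w => (X w, Z w)) (a, c) / law mu Z c.
Proof.
rewrite /cond {1}/law -big_mkcondr /= mulr_suml.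
by apply: eq_bigl => w; rewrite xpair_eqE.
Qed.

Lemma cindep_cond (A B C : finType) (X : O -> A) (Y : O -> B) (Z : O -> C) c :
  cindep mu X Y Z -> 0 < law mu Z c -> indep (cond mu Z c) X Y.
Proof.
move=> i h a b; rewrite !law_cond.
have nz : law mu Z c != 0 by rewrite gt_eqF.
apply: (mulIf nz); rewrite mulrAC i; field.
by [].
Qed.

(** The chain rule: both sides are the conditional entropy of [X] given [Z]. *)
Lemma ent_cond (A C : finType) (X : O -> A) (Z : O -> C) :
  ent mu (fun w => (X w, Z w)) - ent mu Z = \sum_c law mu Z c * ent (cond mu Z c) X.
Proof.
rewrite /ent opprK -[X in _ + X]opprK -opprD -sumrB.
under [RHS]eq_bigr do rewrite mulrN.
rewrite sumrN; congr (- _).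
under eq_bigr do rewrite -mulrBr.
rewrite (partition_big Z predT) //=; apply: eq_bigr => c _.
have [h|h] := ltP 0 (law mu Z c); last first.
  have z : law mu Z c = 0 by apply/eqP; rewrite eq_le h law_ge0.
  rewrite z mul0r big1 // => w /eqP Zw.
  have := mu_prob.1 w; rewrite le_eqVlt => /orP[/eqP <-|mw]; first by rewrite mul0r.
  by have := law_gt0 mu_prob Z mw; rewrite Zw z ltxx.
rewrite mulr_sumr.
under [RHS]eq_bigr => w _ do rewrite /cond law_cond mulrA.
rewrite big_mkcond /=; apply: eq_bigr => w _.
case: eqP => [Zw|]; last by rewrite mulr0 mul0r.
rewrite mulrCA divff ?gt_eqF // mulr1.
have := mu_prob.1 w; rewrite le_eqVlt => /orP[/eqP <-|mw]; first by rewrite !mul0r.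
rewrite Zw ln_div ?posrE //.
by have := law_gt0 mu_prob (fun w => (X w, Z w)) mw; rewrite Zw.
Qed.

Lemma law_copies (A B C : finType) (X : O -> A) (Y : O -> B) (Z : O -> C) a b c :
  law (cond_copies mu Z) (fun w => (X w.1, Y w.2, Z w.1)) (a, b, c) =
  law mu (fun w => (X w, Z w)) (a, c) * law mu (fun w => (Y w, Z w)) (b, c) / law mu Z c.
Proof.
rewrite /law big_distrlr /= pair_big /= mulr_suml.
rewrite big_mkcond [RHS]big_mkcond /=; apply: eq_bigr => [] [v w] _ /=.
rewrite /cond_copies /= !xpair_eqE.
case: (X v =P a) => //= _; case: (Y w =P b) => _ /=; rewrite ?andbF //.
case: (Z v =P c) => //= ->; rewrite eq_sym; case: eqP => // _.
Qed.

Lemma cond_copies_prob (C : finType) (Z : O -> C) : prob (cond_copies mu Z).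
Proof.
split=> [[v w]|].
  rewrite /cond_copies /=; case: ifP => // _.
  by rewrite divr_ge0 ?mulr_ge0 ?(law_ge0 mu_prob) //; apply: mu_prob.1.
(* The two unit coordinates bring each block into the shape treated by [law_copies]. *)
rewrite (partition_big (fun w => (tt, tt, Z w.1)) predT) //=.
rewrite (eq_bigr (fun t : unit * unit * C => law mu Z t.2)); last first.
  move=> [[[] []] c] _; rewrite -/(law _ (fun w => (tt, tt, Z w.1)) _).
  rewrite (law_copies (fun=> tt) (fun=> tt) Z) /=.
  have -> : law mu (fun w => (tt, Z w)) (tt, c) = law mu Z c by apply: eq_bigl => w.
  have [->|nz] := eqVneq (law mu Z c) 0; first by rewrite mul0r mul0r.
  by rewrite mulfK.
rewrite -(pair_bigA _ (fun a c => law mu Z c)) /=.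
rewrite big_const card_prod card_unit /= addr0.
by case: (law_prob mu_prob Z).
Qed.

Lemma cond_copies_eq (C : finType) (Z : O -> C) w : 0 < cond_copies mu Z w -> Z w.1 = Z w.2.
Proof. by rewrite /cond_copies; case: eqP => //; rewrite ltxx. Qed.

Lemma law_copies1 (A C : finType) (X : O -> A) (Z : O -> C) a c :
  law (cond_copies mu Z) (fun w => (X w.1, Z w.1)) (a, c) = law mu (fun w => (X w, Z w)) (a, c).
Proof.
have := law_copies X (fun=> tt) Z a tt c.
have -> : law mu (fun w => (tt, Z w)) (tt, c) = law mu Z c by apply: eq_bigl => w.
have -> : law (cond_copies mu Z) (fun w => (X w.1, tt, Z w.1)) (a, tt, c) =
   law (cond_copies mu Z) (fun w => (X w.1, Z w.1)) (a, c).
  by apply: eq_bigl => w; rewrite !xpair_eqE andbT.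
move=> ->; have [z|nz] := eqVneq (law mu Z c) 0; last by rewrite mulfK.
rewrite z mulr0 mul0r; apply/esym/eqP; rewrite eq_le law_ge0 // andbT -z.
rewrite -(law_fst mu X Z) (bigD1 a) //= lerDl; apply: sumr_ge0 => *; exact: law_ge0.
Qed.

Lemma cond_copiesC (C : finType) (Z : O -> C) v w :
  cond_copies mu Z (v, w) = cond_copies mu Z (w, v).
Proof.
by rewrite /cond_copies /= eq_sym; case: eqP => // ->; rewrite [mu v * _]mulrC.
Qed.

(** Exchanging the copies reduces this to [law_copies1]. The second coordinate may stay [Z w.1],
    which equals [Z w.2] wherever the weight is nonzero. *)
Lemma law_copies2 (A C : finType) (X : O -> A) (Z : O -> C) a c :
  law (cond_copies mu Z) (fun w => (X w.2, Z w.1)) (a, c) = law mu (fun w => (X w, Z w)) (a, c).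
Proof.
rewrite -law_copies1 /law.
rewrite (reindex_inj (h := fun w : O * O => (w.2, w.1))) /=; last by move=> [? ?] [? ?] [-> ->].
rewrite big_mkcond [RHS]big_mkcond; apply: eq_bigr => [] [v w] _ /=.
rewrite cond_copiesC /cond_copies /=; case: (Z v =P Z w) => [->|_] //.
by rewrite !if_same.
Qed.

Lemma cindep_copies (A B C : finType) (X : O -> A) (Y : O -> B) (Z : O -> C) :
  cindep (cond_copies mu Z) (fun w => X w.1) (fun w => Y w.2) (fun w => Z w.1).
Proof.
move=> a b c; rewrite law_copies law_copies1 law_copies2.
have <- : law mu Z c = law (cond_copies mu Z) (fun w => Z w.1) c.
  have := law_copies1 (fun=> tt) Z tt c.
  have -> : law mu (fun w => (tt, Z w)) (tt, c) = law mu Z c by apply: eq_bigl => w.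
  by move=> <-; apply: eq_bigl => w.
have [z|nz] := eqVneq (law mu Z c) 0; last by rewrite mulfVK.
have -> : law mu (fun w => (X w, Z w)) (a, c) = 0.
  apply/eqP; rewrite eq_le law_ge0 // andbT -z.
  rewrite -(law_fst mu X Z) (bigD1 a) //= lerDl; apply: sumr_ge0 => *; exact: law_ge0.
by rewrite !mul0r.
Qed.

Lemma law_copies_fst (C X : finType) (Z : O -> C) (F : O -> X) :
  law (cond_copies mu Z) (fun w => F w.1) = law mu F.
Proof.
apply/funext => x; rewrite -(law_snd mu F Z) -(law_snd _ (fun w => F w.1) (fun w => Z w.1)).
by apply: eq_bigr => c _; rewrite law_copies1.
Qed.

Lemma law_copies_snd (C X : finType) (Z : O -> C) (F : O -> X) :
  law (cond_copies mu Z) (fun w => F w.2) = law mu F.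
Proof.
apply/funext => x; rewrite -(law_snd mu F Z) -(law_snd _ (fun w => F w.2) (fun w => Z w.1)).
by apply: eq_bigr => c _; rewrite law_copies2.
Qed.

Lemma ent_copies1 (C X : finType) (Z : O -> C) (F : O -> X) :
  ent (cond_copies mu Z) (fun w => F w.1) = ent mu F.
Proof. by rewrite !entE law_copies_fst. Qed.

Lemma ent_copies2 (C X : finType) (Z : O -> C) (F : O -> X) :
  ent (cond_copies mu Z) (fun w => F w.2) = ent mu F.
Proof. by rewrite !entE law_copies_snd. Qed.

End Fixed.
End Independence.

(** * Ruzsa distance in groups of exponent two *)

(* Reflexive proofs of identities between sums of variables in a group of exponent two: both
   sides contain each variable with the same parity. *)
Section Char2.
Variable G : zmodType.
Hypothesis addGG : forall x : G, x + x = 0.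

Inductive sumexp := SumAtom of nat | SumAdd of sumexp & sumexp.

Fixpoint sumexp_val (env : seq G) e :=
  match e with SumAtom i => env`_i | SumAdd a b => sumexp_val env a + sumexp_val env b end.

Fixpoint sumexp_parity e i :=
  match e with SumAtom j => i == j | SumAdd a b => sumexp_parity a i (+) sumexp_parity b i end.

Lemma sumexp_valE env e :
  sumexp_val env e = \sum_(i < size env) if sumexp_parity e i then env`_i else 0.
Proof.
elim: e => [j|a iha b ihb] /=; last first.
  rewrite iha ihb -big_split /=; apply: eq_bigr => i _.
  by case: (sumexp_parity a i); case: (sumexp_parity b i); rewrite ?addr0 ?add0r ?addGG.
(* An atom beyond the end of [env] evaluates to the default 0, and no index of the sum meets it. *)
have [lt|ge] := ltnP j (size env); last first.
  rewrite nth_default // big1 // => i _.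
  by rewrite ltn_eqF // (leq_trans (ltn_ord i)).
rewrite -big_mkcond (big_pred1 (Ordinal lt)) //=.
Qed.

Lemma sumexp_val_eq env e1 e2 :
  all (fun i => sumexp_parity e1 i == sumexp_parity e2 i) (iota 0 (size env)) ->
  sumexp_val env e1 = sumexp_val env e2.
Proof.
move=> /allP h; rewrite !sumexp_valE; apply: eq_bigr => i _.
by rewrite (eqP (h i _)) // mem_iota add0n ltn_ord.
Qed.
End Char2.

Ltac atom_index x env :=
  lazymatch env with
  | cons x _ => constr:(0%N)
  | cons _ ?env' => let n := atom_index x env' in constr:(S n)
  end.
Ltac quote_sum env e :=
  lazymatch e with
  | ?a + ?b => let a' := quote_sum env a in let b' := quote_sum env b in constr:(SumAdd a' b')
  | ?x => let n := atom_index x env in constr:(SumAtom n)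
  end.
(** Every atom of either side must be listed in [env]; the parity check is then settled by
    computation, with [isT] as its proof. *)
Ltac char2 H env :=
  lazymatch goal with |- ?a = ?b =>
    let a' := quote_sum env a in let b' := quote_sum env b in
    exact: (@sumexp_val_eq _ H env a' b' isT)
  end.

Section Sums.
Variables (R : realType) (G : finZmodType).
Hypothesis addGG : forall x : G, x + x = 0.
Implicit Types p q r : G -> R.

Definition conv p q : G -> R := law (prodm p q) (fun w => w.1 + w.2).
Definition lent p : R := ent p id.
(* The usual definition uses [X - Y], which is [X + Y] here. *)
Definition rdist p q : R := lent (conv p q) - lent p / 2 - lent q / 2.

Lemma conv_prob p q : prob p -> prob q -> prob (conv p q).
Proof. by move=> *; apply/law_prob/prodm_prob. Qed.

Lemma lent_law (O : finType) (mu : O -> R) (X : O -> G) : lent (law mu X) = ent mu X.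
Proof. exact: ent_push. Qed.

Lemma law_add (O : finType) (mu : O -> R) (X Y : O -> G) :
  indep mu X Y -> law mu (fun w => X w + Y w) = conv (law mu X) (law mu Y).
Proof.
move=> i; apply/funext => g.
rewrite (law_comp mu (fun w => (X w, Y w)) (fun t => t.1 + t.2)) /conv.
by apply: eq_bigr => [] [a b] _; rewrite i.
Qed.

Lemma lent_conv (O : finType) (mu : O -> R) (X Y : O -> G) :
  indep mu X Y -> lent (conv (law mu X) (law mu Y)) = ent mu (fun w => X w + Y w).
Proof. by move=> i; rewrite -law_add // lent_law. Qed.

Lemma convC p q : conv p q = conv q p.
Proof.
apply/funext => g; rewrite /conv /law.
rewrite (reindex_inj (h := fun w : G * G => (w.2, w.1))) /=; last by move=> [? ?] [? ?] [-> ->].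
by apply: eq_big => [] [a b] /=; rewrite ?(addrC b) // /prodm /= mulrC.
Qed.

Lemma rdistC p q : rdist p q = rdist q p.
Proof. rewrite /rdist convC; lra. Qed.

(** Mutual independence of four variables, with pairs nested as in the product space of [prod4]. The
    transpositions below give every reordering used later. *)
Definition indep4 (O : finType) (mu : O -> R) (Y1 Y2 Y3 Y4 : O -> G) :=
  forall a b c d, law mu (fun w => (Y1 w, Y2 w, (Y3 w, Y4 w))) (a, b, (c, d)) =
    law mu Y1 a * law mu Y2 b * (law mu Y3 c * law mu Y4 d).

Section Joint.
Variables (O : finType) (mu : O -> R).
Hypothesis mu_prob : prob mu.
Variables (Y1 Y2 Y3 Y4 : O -> G).

Lemma indep4_swap12 : indep4 mu Y1 Y2 Y3 Y4 -> indep4 mu Y2 Y1 Y3 Y4.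
Proof.
move=> j a b c d; rewrite [law mu Y2 a * _]mulrC -j; apply: eq_bigl => w.
by rewrite !xpair_eqE [(Y2 w == _) && _]andbC.
Qed.

Lemma indep4_swap13 : indep4 mu Y1 Y2 Y3 Y4 -> indep4 mu Y3 Y2 Y1 Y4.
Proof.
move=> j a b c d.
rewrite (_ : _ * _ * _ = law mu Y1 c * law mu Y2 b * (law mu Y3 a * law mu Y4 d)); last ring.
rewrite -j; apply: eq_bigl => w.
by rewrite !xpair_eqE; do 4 case: eqP.
Qed.

Lemma indep4_swap34 : indep4 mu Y1 Y2 Y3 Y4 -> indep4 mu Y1 Y2 Y4 Y3.
Proof.
move=> j a b c d; rewrite [law mu Y4 c * _]mulrC -j; apply: eq_bigl => w.
by rewrite !xpair_eqE [(Y4 w == _) && _]andbC.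
Qed.

Lemma indep4_swap23 : indep4 mu Y1 Y2 Y3 Y4 -> indep4 mu Y1 Y3 Y2 Y4.
Proof.
move=> j a b c d.
rewrite (_ : _ * _ * _ = law mu Y1 a * law mu Y2 c * (law mu Y3 b * law mu Y4 d)); last ring.
rewrite -j; apply: eq_bigl => w.
by rewrite !xpair_eqE; do 4 case: eqP.
Qed.

Lemma sum_law1 (X : O -> G) : \sum_a law mu X a = 1.
Proof. by case: (law_prob mu_prob X). Qed.

Lemma indep4_pair12 : indep4 mu Y1 Y2 Y3 Y4 -> indep mu Y1 Y2.
Proof.
move=> j a b; rewrite -(law_snd mu (fun w => (Y1 w, Y2 w)) (fun w => (Y3 w, Y4 w))).
rewrite (eq_bigr (fun t : G * G => law mu Y1 a * law mu Y2 b * (law mu Y3 t.1 * law mu Y4 t.2))).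
  rewrite -mulr_sumr -(pair_bigA _ (fun c d => law mu Y3 c * law mu Y4 d)) /=.
  by rewrite -big_distrlr /= !sum_law1 !mulr1.
by move=> [c d] _; rewrite j.
Qed.

End Joint.

Lemma indep4_pairs (O : finType) (mu : O -> R) (Y1 Y2 Y3 Y4 : O -> G) : prob mu ->
  indep4 mu Y1 Y2 Y3 Y4 -> indep mu (fun w => (Y1 w, Y2 w)) (fun w => (Y3 w, Y4 w)).
Proof.
move=> m j [a b] [c d].
have j' : indep4 mu Y3 Y4 Y1 Y2.
  by apply/indep4_swap23/indep4_swap12/indep4_swap34/indep4_swap23.
by rewrite (indep4_pair12 m j a b) (indep4_pair12 m j' c d) j.
Qed.

Definition prod4 p1 p2 p3 p4 : (G * G) * (G * G) -> R := prodm (prodm p1 p2) (prodm p3 p4).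

Lemma law_prodm1 (A B : finType) (p : A -> R) (q : B -> R) : prob q -> law (prodm p q) fst = p.
Proof.
move=> [_ q1]; apply/funext => a; rewrite /law.
rewrite (eq_bigl (fun t : A * B => (t.1 == a) && true)); last by move=> t; rewrite andbT.
rewrite -(pair_big (fun x => x == a) xpredT (fun x y => p x * q y)) /=.
by rewrite big_pred1_eq -mulr_sumr q1 mulr1.
Qed.

Lemma law_prodm2 (A B : finType) (p : A -> R) (q : B -> R) : prob p -> law (prodm p q) snd = q.
Proof.
move=> [_ p1]; apply/funext => b; rewrite /law.
rewrite (eq_bigl (fun t : A * B => true && (t.2 == b))) //.
rewrite -(pair_big xpredT (fun x => x == b) (fun x y => p x * q y)) /=.
under eq_bigr do rewrite big_pred1_eq.
by rewrite -mulr_suml p1 mul1r.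
Qed.

Lemma indep_prodm (A B : finType) (p : A -> R) (q : B -> R) :
  prob p -> prob q -> indep (prodm p q) fst snd.
Proof.
by move=> hp hq a b; rewrite law_prodm1 // law_prodm2 // /law (big_pred1 (a, b)).
Qed.

Section Prod4.
Variables (p1 p2 p3 p4 : G -> R).
Hypotheses (h1 : prob p1) (h2 : prob p2) (h3 : prob p3) (h4 : prob p4).

Lemma prod4_prob : prob (prod4 p1 p2 p3 p4).
Proof. by apply: prodm_prob; apply: prodm_prob. Qed.

Lemma law_prod4_1 : law (prod4 p1 p2 p3 p4) (fun w => w.1.1) = p1.
Proof.
apply/funext => a; rewrite (law_comp _ fst (fun t : G * G => t.1)).
by rewrite law_prodm1 ?[RHS](esym (congr1 (@^~ a) (law_prodm1 p1 h2))) //; apply: prodm_prob.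
Qed.

Lemma law_prod4_2 : law (prod4 p1 p2 p3 p4) (fun w => w.1.2) = p2.
Proof.
apply/funext => a; rewrite (law_comp _ fst (fun t : G * G => t.2)).
by rewrite law_prodm1 ?[RHS](esym (congr1 (@^~ a) (law_prodm2 p2 h1))) //; apply: prodm_prob.
Qed.

Lemma law_prod4_3 : law (prod4 p1 p2 p3 p4) (fun w => w.2.1) = p3.
Proof.
apply/funext => a; rewrite (law_comp _ snd (fun t : G * G => t.1)).
by rewrite law_prodm2 ?[RHS](esym (congr1 (@^~ a) (law_prodm1 p3 h4))) //; apply: prodm_prob.
Qed.

Lemma law_prod4_4 : law (prod4 p1 p2 p3 p4) (fun w => w.2.2) = p4.
Proof.
apply/funext => a; rewrite (law_comp _ snd (fun t : G * G => t.2)).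
by rewrite law_prodm2 ?[RHS](esym (congr1 (@^~ a) (law_prodm2 p4 h3))) //; apply: prodm_prob.
Qed.

Lemma indep4_prod4 : indep4 (prod4 p1 p2 p3 p4)
  (fun w => w.1.1) (fun w => w.1.2) (fun w => w.2.1) (fun w => w.2.2).
Proof.
move=> a b c d; rewrite law_prod4_1 law_prod4_2 law_prod4_3 law_prod4_4.
rewrite /law (big_pred1 ((a, b), (c, d))) // => [[[x y] [z t]]].
Qed.
End Prod4.

(** For independent [X] and [Y], the pair [(X + Y, Y)] determines [X]; subadditivity for this pair
    gives the bound. *)
Lemma lent_conv_ge p q : prob p -> prob q -> lent p <= lent (conv p q).
Proof.
move=> hp hq; have m := prodm_prob hp hq; have i := indep_prodm hp hq.
have := indep_ent m i; rewrite -[ent _ fst]lent_law -[ent _ snd]lent_law.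
rewrite law_prodm1 // law_prodm2 //.
rewrite (@ent_determined _ _ _ m _ _ (fun w => (w.1, w.2)) (fun w => (w.1 + w.2, w.2))
  (fun w => (w.1 + w.2, w.2)) (fun w => (w.1 + w.2, w.2))) //=; last first.
  by move=> [a b] _ /=; rewrite -addrA addGG addr0.
have := ent_subadd m (fun w => w.1 + w.2) snd.
rewrite -[ent _ snd]lent_law law_prodm2 // -[ent _ (fun w => _ + _)]lent_law -/(conv p q).
lra.
Qed.

(** The entropy of the sum is at least that of either summand. *)
Lemma rdist_ge p q : prob p -> prob q -> `|lent p - lent q| <= 2 * rdist p q.
Proof.
move=> hp hq; have a := lent_conv_ge hp hq; have := lent_conv_ge hq hp; rewrite convC => b.
rewrite /rdist ler_norml; apply/andP; split; lra.
Qed.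

Lemma rdist_ge0 p q : prob p -> prob q -> 0 <= rdist p q.
Proof. by move=> hp hq; have := rdist_ge hp hq; have := normr_ge0 (lent p - lent q); lra. Qed.

(* Submodularity for [X] and [Z] over [X + Y + Z]. *)
Lemma lent_conv3 p q r : prob p -> prob q -> prob r ->
  lent (conv p (conv q r)) + lent q <= lent (conv p q) + lent (conv q r).
Proof.
move=> hp hq hr; have m := prod4_prob hp hq hr hr; have j := indep4_prod4 hp hq hr hr.
set mu := prod4 _ _ _ _ in m j.
pose X (w : (G * G) * (G * G)) := w.1.1; pose Y (w : (G * G) * (G * G)) := w.1.2.
pose Z (w : (G * G) * (G * G)) := w.2.1; pose T (w : (G * G) * (G * G)) := w.2.2.
have lX : law mu X = p by exact: law_prod4_1.
have lY : law mu Y = q by exact: law_prod4_2.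
have lZ : law mu Z = r by exact: law_prod4_3.
have iXY : indep mu X Y := indep4_pair12 m j.
have iXZ : indep mu X Z := indep4_pair12 m (indep4_swap23 j).
have iYZ : indep mu Y Z := indep4_pair12 m (indep4_swap23 (indep4_swap12 j)).
have i4 := indep4_pairs m j.
have iX_YZ : indep mu X (fun w => Y w + Z w).
  have i := indep4_pairs m (indep4_swap23 (indep4_swap12 j)).
  exact: indepC (indep_comp (fun t => t.1 + t.2) (fun t : G * G => t.1) i).
have iZ_XY : indep mu (fun w => X w + Y w) Z.
  exact: (indep_comp (fun t => t.1 + t.2) (fun t : G * G => t.1) i4).
have iXY_Z : indep mu (fun w => (X w, Y w)) Z.
  exact: (indep_comp id (fun t : G * G => t.1) i4).
have := ent_submod m X Z (fun w => X w + (Y w + Z w)).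
rewrite (@ent_determined _ _ _ m _ _ (fun w => (X w, Z w, X w + (Y w + Z w)))
  (fun w => (X w, Y w, Z w)) (fun t => (t.1.1, t.2 + t.1.1 + t.1.2, t.1.2))
  (fun t => (t.1.1, t.2, t.1.1 + (t.1.2 + t.2)))); first last.
- by [].
- by move=> w _ /=; congr (_, _, _); char2 addGG [:: X w; Y w; Z w].
rewrite (@ent_determined _ _ _ m _ _ (fun w => (X w, X w + (Y w + Z w)))
  (fun w => (X w, Y w + Z w)) (fun t => (t.1, t.2 + t.1)) (fun t => (t.1, t.1 + t.2))); first last.
- by [].
- by move=> w _ /=; congr (_, _); char2 addGG [:: X w; Y w; Z w].
rewrite (@ent_determined _ _ _ m _ _ (fun w => (Z w, X w + (Y w + Z w)))
  (fun w => (X w + Y w, Z w)) (fun t => (t.1 + t.2, t.1)) (fun t => (t.2, t.1 + t.2))); first last.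
- by move=> w _ /=; rewrite addrA.
- by move=> w _ /=; congr (_, _); char2 addGG [:: X w; Y w; Z w].
rewrite !(indep_ent m) // -!lent_conv // !lent_law.
rewrite (law_add iYZ) lX lY lZ.
rewrite -(lent_law mu X) -(lent_law mu Y) -(lent_law mu Z) lX lY lZ; lra.
Qed.

(* Submodularity for [X + Y] and [X] over [X + Z]. *)
Lemma rdist_tri p q r : prob p -> prob q -> prob r -> rdist p r <= rdist p q + rdist q r.
Proof.
move=> hp hq hr; have m := prod4_prob hp hq hr hr; have j := indep4_prod4 hp hq hr hr.
set mu := prod4 _ _ _ _ in m j.
pose X (w : (G * G) * (G * G)) := w.1.1; pose Y (w : (G * G) * (G * G)) := w.1.2.
pose Z (w : (G * G) * (G * G)) := w.2.1.
have lX : law mu X = p by exact: law_prod4_1.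
have lY : law mu Y = q by exact: law_prod4_2.
have lZ : law mu Z = r by exact: law_prod4_3.
have iXY : indep mu X Y := indep4_pair12 m j.
have iXZ : indep mu X Z := indep4_pair12 m (indep4_swap23 j).
have iYZ : indep mu Y Z := indep4_pair12 m (indep4_swap23 (indep4_swap12 j)).
have iXY_Z : indep mu (fun w => (X w, Y w)) Z.
  exact: (indep_comp id (fun t : G * G => t.1) (indep4_pairs m j)).
have := ent_submod m (fun w => X w + Y w) X (fun w => X w + Z w).
rewrite (@ent_determined _ _ _ m _ _ (fun w => (X w + Y w, X w, X w + Z w))
  (fun w => (X w, Y w, Z w)) (fun t => (t.1.2, t.1.1 + t.1.2, t.1.2 + t.2))
  (fun t => (t.1.1 + t.1.2, t.1.1, t.1.1 + t.2))); first last.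
- by [].
- by move=> w _ /=; congr (_, _, _); char2 addGG [:: X w; Y w; Z w].
rewrite (@ent_determined _ _ _ m _ _ (fun w => (X w, X w + Z w))
  (fun w => (X w, Z w)) (fun t => (t.1, t.1 + t.2)) (fun t => (t.1, t.1 + t.2))); first last.
- by [].
- by move=> w _ /=; congr (_, _); char2 addGG [:: X w; Y w; Z w].
(* In exponent two [(X + Y) + (X + Z) = Y + Z]; this is how the distance between [q] and [r]
   enters. *)
rewrite (@ent_determined _ _ _ m _ _ (fun w => (X w + Y w, X w + Z w))
  (fun w => (X w + Y w, Y w + Z w)) (fun t => (t.1, t.1 + t.2)) (fun t => (t.1, t.1 + t.2)));
  first last.
- by move=> w _ /=; congr (_, _); char2 addGG [:: X w; Y w; Z w].
- by move=> w _ /=; congr (_, _); char2 addGG [:: X w; Y w; Z w].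
have := ent_subadd m (fun w => X w + Y w) (fun w => Y w + Z w).
rewrite (indep_ent m iXY_Z) (indep_ent m iXY) (indep_ent m iXZ).
rewrite -(lent_conv iXY) -(lent_conv iXZ) -(lent_conv iYZ) lX lY lZ.
rewrite -(lent_law mu X) -(lent_law mu Y) -(lent_law mu Z) lX lY lZ /rdist; lra.
Qed.

End Sums.

(** * Minimizers of the penalized distance *)

Section Minimizer.
Variables (R : realType) (G : finZmodType).
Hypothesis addGG : forall x : G, x + x = 0.

(** For [X] distributed as [p] and independent of [(A, Z)], the left side is the entropy of [X + A]
    given [Z], and conditioning does not increase entropy. *)
Lemma ent_conv_cond (O T : finType) (mu : O -> R) (A : O -> G) (Z : O -> T) (p : G -> R) :
  prob p -> prob mu ->
  \sum_c law mu Z c * lent (conv p (law (cond mu Z c) A)) <= lent (conv p (law mu A)).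
Proof.
move=> hp hm; have m := prodm_prob hp hm.
have indepA (nu : O -> R) : prob nu -> indep (prodm p nu) fst (fun w => A w.2).
  by move=> hn; exact: (indep_comp id A (indep_prodm hp hn)).
have lawA (nu : O -> R) : prob nu -> law (prodm p nu) (fun w => A w.2) = law nu A.
  by move=> hn; apply/funext => a; rewrite (law_comp _ snd A) law_prodm2.
have lawZ c : law (prodm p mu) (fun w => Z w.2) c = law mu Z c.
  by rewrite (law_comp _ snd Z) law_prodm2.
have entE (nu : O -> R) : prob nu ->
    lent (conv p (law nu A)) = ent (prodm p nu) (fun w => w.1 + A w.2).
  by move=> hn; rewrite -(lent_conv (indepA _ hn)) law_prodm1 // lawA.
have := ent_cond m (fun w => w.1 + A w.2) (fun w => Z w.2).
have := ent_subadd m (fun w => w.1 + A w.2) (fun w => Z w.2).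
rewrite -(entE _ hm) => le e.
rewrite (eq_bigr (fun c => law (prodm p mu) (fun w => Z w.2) c *
  ent (cond (prodm p mu) (fun w => Z w.2) c) (fun w => w.1 + A w.2))); first by rewrite -e; lra.
move=> c _; rewrite lawZ.
have [z|h] := eqVneq (law mu Z c) 0; first by rewrite z !mul0r.
have {}h : 0 < law mu Z c by rewrite lt_neqAle eq_sym h law_ge0.
rewrite entE; last exact: cond_prob.
congr (_ * _); apply: eq_ent => w.
rewrite /cond lawZ /prodm; case: eqP; rewrite ?mulr0 // => _; exact: mulrA.
Qed.

Variables (p1 p2 : G -> R) (eta : R).
Hypotheses (h1 : prob p1) (h2 : prob p2) (eta0 : 0 <= eta).
(** Minimality of the penalized distance takes this form once the triangle inequality has replaced
    the reference pair [(p0, q0)] by [(p1, p2)] itself. *)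
Hypothesis minp : forall p q, prob p -> prob q ->
  rdist p1 p2 <= rdist p q + eta * (rdist p1 p + rdist p2 q).

(* Averages the minimality of (p1, p2) over the fibres of Z. *)
Lemma minimizer_cond (O T : finType) (mu : O -> R) (A B : O -> G) (Z : O -> T) :
  prob mu -> cindep mu A B Z ->
  let a := ent mu (fun w => (A w, Z w)) - ent mu Z in
  let b := ent mu (fun w => (B w, Z w)) - ent mu Z in
  rdist p1 p2 <= ent mu (fun w => (A w + B w, Z w)) - ent mu Z - a / 2 - b / 2
    + eta * (lent (conv p1 (law mu A)) - lent p1 / 2 - a / 2
             + (lent (conv p2 (law mu B)) - lent p2 / 2 - b / 2)).
Proof.
move=> hm i /=; rewrite !ent_cond //.
have l1 := ent_conv_cond A Z h1 hm; have l2 := ent_conv_cond B Z h2 hm.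
set s1 := \sum_c _ in l1; set s2 := \sum_c _ in l2.
set sab := \sum_c _; set sa := \sum_c _; set sb := \sum_c _.
suff : rdist p1 p2 <= sab - sa / 2 - sb / 2 +
    eta * (s1 - lent p1 / 2 - sa / 2 + (s2 - lent p2 / 2 - sb / 2)).
  move/le_trans; apply; rewrite lerD2l ler_wpM2l //; lra.
have Z1 : \sum_c law mu Z c = 1 by case: (law_prob hm Z).
(* Constants are spread over the fibres of [Z], so that the inequality can be proved fibre by
   fibre. *)
have e0 x : x = \sum_c law mu Z c * x by rewrite -mulr_suml Z1 mul1r.
rewrite [leLHS]e0 [lent p1]e0 [lent p2]e0 /s1 /s2 /sab /sa /sb.
rewrite !mulr_suml -!sumrB -big_split /= mulr_sumr -big_split /=.
apply: ler_sum => c _.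
have := law_ge0 hm Z c; rewrite le_eqVlt => /orP[/eqP <-|h]; first by rewrite !mul0r; lra.
have hc := cond_prob hm h; have ic := cindep_cond i h.
have := minp (law_prob hc A) (law_prob hc B).
rewrite [rdist (law _ _) _]/rdist [rdist _ (law _ A)]/rdist [rdist _ (law _ B)]/rdist.
rewrite (lent_conv ic) (lent_law _ A) (lent_law _ B) => le.
have := ler_wpM2l (ltW h) le; move/le_trans; apply.
by rewrite le_eqVlt; apply/orP; left; apply/eqP; field.
Qed.

(* The fibring identity: the two distances [rdist (Y1 + Y3) (Y2 + Y4)] and
   [rdist (Y1 | Y1 + Y3) (Y2 | Y2 + Y4)] and the conditional mutual information bounded here
   add up to [rdist Y1 Y2 + rdist Y3 Y4]; minimality bounds the two distances from below. *)
Lemma fibring (O : finType) (mu : O -> R) (Y1 Y2 Y3 Y4 U V S : O -> G) :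
  prob mu -> indep4 mu Y1 Y2 Y3 Y4 -> law mu Y1 = p1 -> law mu Y2 = p2 ->
  (forall w, U w = Y1 w + Y2 w) -> (forall w, V w = Y2 w + Y4 w) ->
  (forall w, S w = Y1 w + Y2 w + Y3 w + Y4 w) ->
  let p3 := law mu Y3 in let p4 := law mu Y4 in
  ent mu (fun w => (U w, S w)) + ent mu (fun w => (V w, S w))
    - ent mu (fun w => (U w, V w, S w)) - ent mu S <=
  rdist p1 p2 + rdist p3 p4 - 2 * rdist p1 p2 + eta *
   (rdist p1 (conv p1 p3) + rdist p2 (conv p2 p4)
    + (lent (conv p1 p1) - lent p1 / 2 - (lent p1 + lent p3 - lent (conv p1 p3)) / 2)
    + (lent (conv p2 p2) - lent p2 / 2 - (lent p2 + lent p4 - lent (conv p2 p4)) / 2)).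
Proof.
move=> m j l1 l2 /funext -> /funext -> /funext -> /=.
have i12 : indep mu Y1 Y2 := indep4_pair12 m j.
have i13 : indep mu Y1 Y3 := indep4_pair12 m (indep4_swap23 j).
have i24 : indep mu Y2 Y4 := indep4_pair12 m (indep4_swap23 (indep4_swap12 (indep4_swap34 j))).
have i34 : indep mu Y3 Y4.
  apply: (@indep4_pair12 _ _ _ _ m _ _ Y1 Y2).
  by apply/indep4_swap23/indep4_swap12/indep4_swap34/indep4_swap23.
have i12_34 := indep4_pairs m j.
have i13_24 := indep4_pairs m (indep4_swap23 j).
have s12_34 := indep_comp (fun t : G * G => t.1 + t.2) (fun t : G * G => t.1 + t.2) i12_34.
have s13_24 := indep_comp (fun t : G * G => t.1 + t.2) (fun t : G * G => t.1 + t.2) i13_24.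
have c13_24 := indep_comp (fun t : G * G => (t.1, t.1 + t.2))
  (fun t : G * G => (t.1, t.1 + t.2)) i13_24.
have d1 := indep_comp id (fun t : G * G => t.1 + t.2) i13_24.
have d2 := indep_comp (fun t : G * G => t.1 + t.2) id i13_24.
rewrite /= in s12_34 s13_24 c13_24 d1 d2.
pose Z w := (Y1 w + Y3 w, Y2 w + Y4 w).
have hY3 := law_prob m Y3; have hY4 := law_prob m Y4.
(* Lower bound for the first distance: minimality against the laws of [Y1 + Y3] and [Y2 + Y4]. *)
have k1 := minp (conv_prob h1 hY3) (conv_prob h2 hY4).
(* Lower bound for the second distance: minimality on the fibres of [Z], over which [Y1] and [Y2]
   are independent. *)
have := minimizer_cond m (indep_cindep c13_24).
rewrite -/Z /= l1 l2.
(* Every entropy except the joint one of [U], [V] and [S] is now reduced to entropies of the four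
   laws and their convolutions. *)
have -> : ent mu Z = lent (conv p1 (law mu Y3)) + lent (conv p2 (law mu Y4)).
  by rewrite (indep_ent m s13_24) -l1 -l2 !lent_conv.
have -> : ent mu (fun w => (Y1 w, Z w)) =
    lent p1 + lent (law mu Y3) + lent (conv p2 (law mu Y4)).
  rewrite (@ent_determined _ _ _ m _ _ _ (fun w => ((Y1 w, Y3 w), Y2 w + Y4 w))
    (fun t => (t.1, t.1 + t.2.1, t.2.2)) (fun t => (t.1.1, (t.1.1 + t.1.2, t.2)))); first last.
  - by [].
  - by move=> w _ /=; congr (_, _, _); char2 addGG [:: Y1 w; Y3 w].
  by rewrite (indep_ent m d1) (indep_ent m i13) -l1 -l2 (lent_conv i24) !lent_law.
have -> : ent mu (fun w => (Y2 w, Z w)) =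
    lent p2 + lent (law mu Y4) + lent (conv p1 (law mu Y3)).
  rewrite (@ent_determined _ _ _ m _ _ _ (fun w => (Y1 w + Y3 w, (Y2 w, Y4 w)))
    (fun t => (t.2.1, (t.1, t.1 + t.2.2))) (fun t => (t.2.1, (t.1, t.2.1 + t.2.2)))); first last.
  - by [].
  - by move=> w _ /=; congr (_, (_, _)); char2 addGG [:: Y2 w; Y4 w].
  rewrite (indep_ent m d2) (indep_ent m i24) -l1 -l2 (lent_conv i13) !lent_law; lra.
pose Sm w := Y1 w + Y2 w + Y3 w + Y4 w; rewrite -/Sm.
have -> : ent mu (fun w => (Y1 w + Y2 w, Z w)) =
    ent mu (fun w => (Y1 w + Y2 w, Y2 w + Y4 w, Sm w)).
  apply: (ent_determined m (f := fun t => (t.1, t.2.2, t.2.1 + t.2.2))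
    (g := fun t => (t.1.1, (t.1.2 + t.2, t.1.2)))) => w _; rewrite /Sm ?/Z /=.
  - by congr (_, _, _); char2 addGG [:: Y1 w; Y2 w; Y3 w; Y4 w].
  - by congr (_, (_, _)); char2 addGG [:: Y1 w; Y2 w; Y3 w; Y4 w].
have -> : ent mu (fun w => (Y1 w + Y2 w, Sm w)) =
    lent (conv p1 p2) + lent (conv (law mu Y3) (law mu Y4)).
  rewrite -l1 -l2 (lent_conv i12) (lent_conv i34) -(indep_ent m s12_34).
  apply: (ent_determined m (f := fun t => (t.1, t.1 + t.2))
    (g := fun t => (t.1, t.1 + t.2))) => w _; rewrite /Sm ?/Z /=.
  - by congr (_, _); char2 addGG [:: Y1 w; Y2 w; Y3 w; Y4 w].
  - by congr (_, _); char2 addGG [:: Y1 w; Y2 w; Y3 w; Y4 w].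
have -> : ent mu (fun w => (Y2 w + Y4 w, Sm w)) =
    lent (conv p1 (law mu Y3)) + lent (conv p2 (law mu Y4)).
  rewrite -l1 -l2 (lent_conv i13) (lent_conv i24) -(indep_ent m s13_24).
  apply: (ent_determined m (f := fun t => (t.1 + t.2, t.1))
    (g := fun t => (t.2, t.1 + t.2))) => w _; rewrite /Sm ?/Z /=.
  - by congr (_, _); char2 addGG [:: Y1 w; Y2 w; Y3 w; Y4 w].
  - by congr (_, _); char2 addGG [:: Y1 w; Y2 w; Y3 w; Y4 w].
have eS : ent mu Sm = lent (conv (conv p1 (law mu Y3)) (conv p2 (law mu Y4))).
  rewrite -l1 -l2 -(law_add i13) -(law_add i24) (lent_conv s13_24).
  by apply: ent_ext => w; rewrite /Sm; char2 addGG [:: Y1 w; Y2 w; Y3 w; Y4 w].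
rewrite eS; move: k1.
rewrite [rdist (conv _ _) (conv _ _)]/rdist [rdist (law _ _) _]/rdist.
set D1 := rdist p1 (conv _ _); set D2 := rdist p2 (conv _ _).
rewrite [rdist p1 p2]/rdist.
(* The penalties of the two uses of minimality add up to the penalty in the conclusion. *)
set a := (X in eta * X); set b := (X in _ -> _ <= _ + eta * X -> _).
set c := (X in _ -> _ -> _ <= _ + eta * X).
have -> : c = a + b by rewrite /a /b /c; lra.
lra.
Qed.

Lemma ent_pair1 (O A B : finType) (mu : O -> R) (X : O -> A) (Y Y' : O -> B) : prob mu ->
  (forall w, 0 < mu w -> Y w = Y' w) ->
  ent mu (fun w => (X w, Y w)) = ent mu (fun w => (X w, Y' w)).
Proof.
move=> m e; apply: (ent_determined m (f := id) (g := id)) => w mw; by rewrite e.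
Qed.

(* The entropic Balog-Szemeredi-Gowers argument: for copies (A1, B1), (A2, B2) of (A, B),
   independent given [A + B] and [S], one has A1 + B1 = A2 + B2, so A1 + B2 = A2 + B1 is a
   function both of (A1, B2) and of (A2, B1). *)
Lemma bsg_ent (O T : finType) (mu : O -> R) (A B : O -> G) (S : O -> T) : prob mu ->
  let Z w := (A w + B w, S w) in
  let nu := cond_copies mu Z in
  let a := ent mu (fun w => (A w, S w)) in
  let b := ent mu (fun w => (B w, S w)) in
  let s := ent mu S in
  ent nu (fun w => (A w.1 + B w.2, Z w.1)) <=
    2 * a + 2 * b - 3 * s - 2 * ent mu (fun w => (A w, B w, S w)) + 2 * ent mu Z.
Proof.
move=> hm /=; set Z := fun w => (A w + B w, S w); set nu := cond_copies mu Z.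
set a := ent mu (fun w => (A w, S w)); set b := ent mu (fun w => (B w, S w)); set s := ent mu S.
have hn : prob nu by exact: cond_copies_prob.
have Znu w : 0 < nu w -> Z w.1 = Z w.2 by exact: cond_copies_eq.
have e1 (X : finType) (F : O -> X) : ent nu (fun w => F w.1) = ent mu F := ent_copies1 hm Z F.
have e2 (X : finType) (F : O -> X) : ent nu (fun w => F w.2) = ent mu F := ent_copies2 hm Z F.
have S12 w : 0 < nu w -> S w.2 = S w.1 by move=> /Znu [_ ->].
have A2E w : 0 < nu w -> A w.2 = A w.1 + B w.1 + B w.2.
  by move=> /Znu [-> _]; char2 addGG [:: A w.2; B w.2].
have J1 := e1 _ (fun w => (A w, B w, Z w)).
have J2 := e2 _ (fun w => (A w, B w, Z w)).
have JE : ent mu (fun w => (A w, B w, Z w)) = ent mu (fun w => (A w, B w, S w)).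
  exact: (ent_determined hm (f := fun t => (t.1, t.2.2))
    (g := fun t => (t.1, (t.1.1 + t.1.2, t.2)))).
have ci := cindep_ent hn (cindep_copies hm (fun w => (A w, B w)) (fun w => (A w, B w)) Z).
rewrite (e1 _ Z) J1 (ent_pair1 _ hn (Y' := fun w => Z w.2)) // J2 JE in ci.
have sub1 := ent_submod hn (fun w => A w.1) (fun w => B w.1) (fun w => (A w.1 + B w.2, S w.1)).
(* [A1], [B1] and [A1 + B2] determine all four summands, so this is the full joint entropy, which
   [ci] evaluates. *)
have full : ent nu (fun w => (A w.1, B w.1, (A w.1 + B w.2, S w.1))) =
    ent nu (fun w => ((A w.1, B w.1), (A w.2, B w.2), Z w.1)).
  apply: (ent_determined hn
    (f := fun t => (t.1, (t.1.1 + t.1.2 + (t.2.1 + t.1.1), t.2.1 + t.1.1), (t.1.1 + t.1.2, t.2.2)))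
    (g := fun t => (t.1.1, (t.1.1.1 + t.1.2.2, t.2.2)))) => // w hw /=.
  by rewrite A2E // /Z; congr (_, (_, _), _); char2 addGG [:: A w.1; B w.1; B w.2].
(* The two right-hand terms of [sub1] are the entropies of [(A1, B2, S)] and [(B1, A2, S)]; each is
   at most [a + b - s]. *)
have sub2 := ent_submod hn (fun w => A w.1) (fun w => B w.2) (fun w => S w.1).
have sub2E : ent nu (fun w => (A w.1, (A w.1 + B w.2, S w.1))) =
    ent nu (fun w => (A w.1, B w.2, S w.1)).
  apply: (ent_determined hn (f := fun t => (t.1, t.1 + t.2.1, t.2.2))
    (g := fun t => (t.1.1, (t.1.1 + t.1.2, t.2)))) => // w hw /=.
  by congr (_, _, _); char2 addGG [:: A w.1; B w.2].
have sub3 := ent_submod hn (fun w => B w.1) (fun w => A w.2) (fun w => S w.1).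
have sub3E : ent nu (fun w => (B w.1, (A w.1 + B w.2, S w.1))) =
    ent nu (fun w => (B w.1, A w.2, S w.1)).
  apply: (ent_determined hn (f := fun t => (t.1, t.1 + t.2.1, t.2.2))
    (g := fun t => (t.1.1, (t.1.1 + t.1.2, t.2)))) => // w hw /=.
  - by rewrite A2E //; congr (_, _, _); char2 addGG [:: A w.1; B w.1; B w.2].
  - by rewrite A2E //; congr (_, (_, _)); char2 addGG [:: A w.1; B w.1; B w.2].
have eS := e1 _ S.
have eA1 := e1 _ (fun w => (A w, S w)); have eB1 := e1 _ (fun w => (B w, S w)).
have eA2 : ent nu (fun w => (A w.2, S w.1)) = a.
  by rewrite -(ent_pair1 _ hn S12) (e2 _ (fun w => (A w, S w))).
have eB2 : ent nu (fun w => (B w.2, S w.1)) = b.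
  by rewrite -(ent_pair1 _ hn S12) (e2 _ (fun w => (B w, S w))).
(* Passes from [S] to [Z], at the cost of the entropy of [Z] given [S]. *)
have sub4 := ent_submod hn (fun w => A w.1 + B w.2) (fun w => A w.1 + B w.1) (fun w => S w.1).
have sub4E : ent nu (fun w => (A w.1 + B w.2, A w.1 + B w.1, S w.1)) =
    ent nu (fun w => (A w.1 + B w.2, Z w.1)).
  exact: (ent_determined hn (f := fun t => (t.1.1, (t.1.2, t.2)))
    (g := fun t => (t.1, t.2.1, t.2.2))).
have eZ := e1 _ Z; rewrite /Z /= in eZ.
rewrite /Z /= in eS eA1 eB1 sub4E ci full *.
rewrite /a /b /s in eA2 eB2 *.
lra.
Qed.

(** Minimality is applied to [A1] and [B2] on the fibres of [Z = (A + B, S)], and [bsg_ent] bounds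
    the entropy of their sum. Given [Z], each of [A] and [B] determines the other, so both have
    conditional entropy [j - z]. *)
Lemma minimizer_bsg (O T : finType) (mu : O -> R) (A B : O -> G) (S : O -> T) : prob mu ->
  let a := ent mu (fun w => (A w, S w)) in
  let b := ent mu (fun w => (B w, S w)) in
  let z := ent mu (fun w => (A w + B w, S w)) in
  let j := ent mu (fun w => (A w, B w, S w)) in
  rdist p1 p2 <= 2 * a + 2 * b - 3 * ent mu S - 3 * j + 2 * z
    + eta * (lent (conv p1 (law mu A)) + lent (conv p2 (law mu B))
             - lent p1 / 2 - lent p2 / 2 - (j - z)).
Proof.
move=> hm /=; have hn := cond_copies_prob hm (fun w => (A w + B w, S w)).
have := minimizer_cond hn (cindep_copies hm A B (fun w => (A w + B w, S w))).
have := bsg_ent A B S hm.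
rewrite /=; set Z := fun w => (A w + B w, S w).
have Zhn w : 0 < cond_copies mu Z w -> Z w.2 = Z w.1 by move/cond_copies_eq.
rewrite -(ent_pair1 (fun w => B w.2) hn Zhn) (ent_copies1 hm Z Z).
have eA := ent_copies1 hm Z (fun w => (A w, Z w)).
have eB := ent_copies2 hm Z (fun w => (B w, Z w)).
rewrite /= in eA eB; rewrite eA eB.
rewrite (law_copies_fst hm Z A) (law_copies_snd hm Z B).
have -> : ent mu (fun w => (A w, Z w)) = ent mu (fun w => (A w, B w, S w)).
  apply: (ent_determined hm (f := fun t => (t.1, t.1 + t.2.1, t.2.2))
    (g := fun t => (t.1.1, (t.1.1 + t.1.2, t.2)))) => // w _ /=.
  by congr (_, _, _); char2 addGG [:: A w; B w].
have -> : ent mu (fun w => (B w, Z w)) = ent mu (fun w => (A w, B w, S w)).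
  apply: (ent_determined hm (f := fun t => (t.1 + t.2.1, t.1, t.2.2))
    (g := fun t => (t.1.2, (t.1.1 + t.1.2, t.2)))) => // w _ /=.
  by congr (_, _, _); char2 addGG [:: A w; B w].
set x := (X in eta * X); set y := (X in _ -> _ -> _ <= _ + eta * X).
have -> : y = x by rewrite /x /y; lra.
lra.
Qed.

End Minimizer.

(** * Vanishing of the minimal distance, and subgroups from distance zero *)

Section Subgroup.
Variables (R : realType) (G : finZmodType).
Hypothesis addGG : forall x : G, x + x = 0.

(* Minimality bounds the mutual informations of U, V, W = U + V given S by O(eta k), and
   then, through [minimizer_bsg], k itself by O(eta k). *)
Lemma minimizer_rdist_eq0 (p1 p2 : G -> R) : prob p1 -> prob p2 ->
  (forall p q, prob p -> prob q ->
     rdist p1 p2 <= rdist p q + 1000%:R^-1 * (rdist p1 p + rdist p2 q)) ->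
  rdist p1 p2 = 0.
Proof.
set eta := _^-1 => h1 h2 minp; have eta0 : 0 <= eta by rewrite invr_ge0 ler0n.
pose Y1 (w : (G * G) * (G * G)) := w.1.1; pose Y2 (w : (G * G) * (G * G)) := w.1.2.
pose Y3 (w : (G * G) * (G * G)) := w.2.1; pose Y4 (w : (G * G) * (G * G)) := w.2.2.
pose mu := prod4 p1 p2 p1 p2; have m : prob mu by exact: prod4_prob.
have j : indep4 mu Y1 Y2 Y3 Y4 by exact: indep4_prod4.
have l1 : law mu Y1 = p1 by exact: law_prod4_1.
have l2 : law mu Y2 = p2 by exact: law_prod4_2.
have l3 : law mu Y3 = p1 by exact: law_prod4_3.
have l4 : law mu Y4 = p2 by exact: law_prod4_4.
clearbody Y1 Y2 Y3 Y4 mu.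
pose S w := Y1 w + Y2 w + Y3 w + Y4 w; pose Q w := Y2 w + Y4 w.
pose U w := Y1 w + Y2 w; pose V w := Y3 w + Y2 w; pose W w := Y1 w + Y3 w.
(* Three orderings of the quadruple bound the mutual informations given [S] of the pairs [(U, V)],
   [(U, Q)] and [(V, Q)]. *)
have f1 : _ <= _ := fibring addGG h1 h2 eta0 minp m (indep4_swap34 j) l1 l2
  (U := U) (V := V) (S := S) (fun=> erefl) (fun w => addrC _ _) (fun w => addrAC _ _ _).
have f2 : _ <= _ := fibring addGG h1 h2 eta0 minp m j l1 l2
  (U := U) (V := Q) (S := S) (fun=> erefl) (fun=> erefl) (fun=> erefl).
have f3 : _ <= _ := fibring addGG h1 h2 eta0 minp m (indep4_swap13 j) l3 l2
  (U := V) (V := Q) (S := S) (fun=> erefl) (fun=> erefl)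
  (fun w => ltac:(rewrite /S; char2 addGG [:: Y1 w; Y2 w; Y3 w; Y4 w])).
have b := minimizer_bsg addGG h1 h2 eta0 minp U V S m.
rewrite /= l3 l4 in f1 f2; rewrite /= l1 l4 in f3; rewrite /= in b.
have i12 := indep4_pair12 m j.
have i32 := indep4_pair12 m (indep4_swap13 j).
have i1234 := indep_comp (fun t : G * G => t.1 + t.2) (fun t : G * G => t.1 + t.2)
  (indep4_pairs m j).
have i34 : indep mu Y3 Y4.
  apply: (@indep4_pair12 _ _ _ _ m _ _ Y1 Y2).
  by apply/indep4_swap23/indep4_swap12/indep4_swap34/indep4_swap23.
have lU : law mu U = conv p1 p2 by rewrite -l1 -l2 -law_add.
have lV : law mu V = conv p1 p2 by rewrite -l2 -l3 -law_add.
have eU : ent mu (fun w => (U w, S w)) = 2 * lent (conv p1 p2).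
  rewrite (@ent_determined _ _ _ m _ _ _ (fun w => (Y1 w + Y2 w, Y3 w + Y4 w))
    (fun t => (t.1, t.1 + t.2)) (fun t => (t.1, t.1 + t.2))); first last.
  - by move=> w _; rewrite /S /U /=; congr (_, _); char2 addGG [:: Y1 w; Y2 w; Y3 w; Y4 w].
  - by move=> w _; rewrite /S /U /=; congr (_, _); char2 addGG [:: Y1 w; Y2 w; Y3 w; Y4 w].
  rewrite (indep_ent m i1234) -(lent_conv i12) -(lent_conv i34) l1 l2 l3 l4; lra.
have eS : ent mu S = lent (conv (conv p1 p2) (conv p2 p1)).
  rewrite [conv p2 p1]convC -{1}l1 -{1}l2 -l3 -l4 -(law_add i12) -(law_add i34) (lent_conv i1234).
  by apply: ent_ext => w; rewrite /S addrA.
(* [Q + (U + V) = S], so given [S] the variable [Q] carries the same information as [U + V]. *)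
have eQ : ent mu (fun w => (Q w, S w)) = ent mu (fun w => (U w + V w, S w)).
  apply: (ent_determined m (f := fun t => (t.1 + t.2, t.2))
    (g := fun t => (t.1 + t.2, t.2))) => w _; rewrite /Q /U /V /S /=.
  - by congr (_, _); char2 addGG [:: Y1 w; Y2 w; Y3 w; Y4 w].
  - by congr (_, _); char2 addGG [:: Y1 w; Y2 w; Y3 w; Y4 w].
have eUQ : ent mu (fun w => (U w, Q w, S w)) = ent mu (fun w => (U w, V w, S w)).
  apply: (ent_determined m (f := fun t => (t.1.1, t.1.1 + t.1.2 + t.2, t.2))
    (g := fun t => (t.1.1, t.1.1 + t.1.2 + t.2, t.2))) => w _; rewrite /Q /U /V /S /=.
  - by congr (_, _, _); char2 addGG [:: Y1 w; Y2 w; Y3 w; Y4 w].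
  - by congr (_, _, _); char2 addGG [:: Y1 w; Y2 w; Y3 w; Y4 w].
have eVQ : ent mu (fun w => (V w, Q w, S w)) = ent mu (fun w => (U w, V w, S w)).
  apply: (ent_determined m (f := fun t => (t.1.1 + t.1.2 + t.2, t.1.1, t.2))
    (g := fun t => (t.1.2, t.1.1 + t.1.2 + t.2, t.2))) => w _; rewrite /Q /U /V /S /=.
  - by congr (_, _, _); char2 addGG [:: Y1 w; Y2 w; Y3 w; Y4 w].
  - by congr (_, _, _); char2 addGG [:: Y1 w; Y2 w; Y3 w; Y4 w].
rewrite eQ eUQ eS eU in f2; rewrite eQ eVQ eS in f3.
rewrite eS eU in f1; rewrite lU lV eS eU in b.
have cC : conv p2 p1 = conv p1 p2 := convC p2 p1.
(* These inequalities bound the entropy of [S] and the penalty terms. With weight 1/1000 on the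
   penalties, a linear combination forces the distance to be at most 0. *)
have k12 := lent_conv3 addGG (conv_prob h1 h2) h2 h1.
have k112 := lent_conv3 addGG h1 h1 h2; have k111 := lent_conv3 addGG h1 h1 h1.
have k221 := lent_conv3 addGG h2 h2 h1; have k222 := lent_conv3 addGG h2 h2 h2.
have t1 := rdist_tri addGG h1 h2 h1; have t2 := rdist_tri addGG h2 h1 h2.
have g0 := rdist_ge0 addGG h1 h2.
have := rdist_ge addGG h1 h2; rewrite ler_norml => /andP[g1 g2].
rewrite [conv (conv p1 p2) p2]convC in k12.
rewrite (rdistC p2 p1) in f1 t1 t2.
rewrite cC in f1 f2 f3 b k12 k221 eS.
apply/eqP; rewrite eq_le g0 andbT.
move: f1 f2 f3 b k12 k112 k111 k221 k222 t1 t2 g0 g1 g2.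
rewrite /rdist.
set c12 := lent (conv p1 p2); set c11 := lent (conv p1 p1); set c22 := lent (conv p2 p2).
set c112 := lent (conv p1 (conv p1 p2)); set c111 := lent (conv p1 (conv p1 p1)).
set c221 := lent (conv p2 (conv p1 p2)); set c222 := lent (conv p2 (conv p2 p2)).
set s := lent (conv (conv p1 p2) _).
set v := ent mu (fun w => (V w, S w)); set x := ent mu (fun w => (U w + V w, S w)).
set J := ent mu (fun w => (U w, V w, S w)).
set a1 := lent p1; set a2 := lent p2.
rewrite /eta.
clear.
clearbody c12 c11 c22 c112 c111 c221 c222 s v x J a1 a2.
lra.
Qed.

(* [X + X'] for independent copies X, X' of p has the entropy of X, so equality holds in the
   Gibbs inequality for (X + X', X'): p is constant on its support A, and so is [conv p p] on
   A + A, whence A + A has the size of A. *)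
Lemma rdist_self_eq0 (p : G -> R) : prob p -> rdist p p = 0 ->
  exists (H : {set G}) (x0 : G), [/\ 0 \in H, {in H &, forall x y, x + y \in H} &
    forall x, p x = if x + x0 \in H then #|H|%:R^-1 else 0].
Proof.
move=> hp d0; have m := prodm_prob hp hp; have i := indep_prodm hp hp.
pose r := conv p p; have hr : prob r by exact: conv_prob.
have Hr : lent r = lent p by move: d0; rewrite /rdist -/r; lra.
pose T (w : G * G) := (w.1 + w.2, w.2).
have T_inj : injective T by move=> [a b] [c d] [/[swap] -> /addIr ->].
have lawT w : law (prodm p p) T (T w) = prodm p p w.
  by rewrite /law (big_pred1 w) // => v; rewrite /= (inj_eq T_inj).
pose q (t : G * G) := r t.1 * p t.2.
have pos w : 0 < prodm p p w -> (0 < p w.1) * (0 < p w.2) * (0 < r (w.1 + w.2)).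
  move=> mw; have := law_gt0 m (fun w => w.1 + w.2) mw.
  have := law_gt0 m fst mw; have := law_gt0 m snd mw.
  by rewrite law_prodm1 // law_prodm2.
have posq t : 0 < law (prodm p p) T t -> 0 < q t.
  by case/(law_gt0_ex m) => w <- /pos [[_ a] b]; rewrite /q mulr_gt0.
have [q0 q1] : prob q by exact: prodm_prob.
have [|_] := gibbs_with_equality m (X := T) q0 _ posq; first by rewrite q1.
(* Equality case: both the entropy of [T] and its cross entropy against [q] equal twice the entropy
   of [p]. *)
have -> : - \sum_w prodm p p w * ln (q (T w)) = ent (prodm p p) T.
  rewrite (eq_mu_sum m (G := fun w => ln (r (w.1 + w.2)) + ln (p w.2))); last first.
    by move=> w /pos [[_ a] b]; rewrite lnM.
  under eq_bigr do rewrite mulrDr.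
  rewrite big_split /= opprD.
  have -> : - \sum_w prodm p p w * ln (r (w.1 + w.2)) = lent p.
    by rewrite -Hr; apply/esym/(lent_law (prodm p p) (fun w => w.1 + w.2)).
  have -> : - \sum_w prodm p p w * ln (p w.2) = lent p.
    by have l2 := law_prodm2 p hp; rewrite -[in RHS]l2 lent_law /ent l2.
  rewrite (@ent_determined _ _ _ m _ _ T (fun w => (w.1, w.2))
    (fun w => (w.1 + w.2, w.2)) (fun w => (w.1 + w.2, w.2))) //=; last first.
    by move=> w _; rewrite /T -addrA addGG addr0; case: w.
  by rewrite (indep_ent m i) -!lent_law law_prodm1 // law_prodm2.
move=> /(_ (lexx _)) eqT.
have rE x y : 0 < p x -> 0 < p y -> r (x + y) = p x.
  move=> px py; have := eqT (T (x, y)); rewrite lawT /prodm /= mulr_gt0 // => /(_ isT).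
  by apply: mulIf; rewrite gt_eqF.
have pE x y : 0 < p x -> 0 < p y -> p x = p y.
  by move=> px py; rewrite -(rE x y) // addrC rE.
have ge0 := hp.1.
have [x0 px0] : exists x, 0 < p x.
  apply/existsP; apply: contraT; rewrite negb_exists => /forallP none.
  have := hp.2; rewrite big1 => [/eqP|x _]; first by rewrite eq_sym oner_eq0.
  by apply/eqP; rewrite eq_le ge0 andbT leNgt none.
have card_cst (f : G -> R) : prob f -> (forall x, 0 < f x -> f x = p x0) ->
    #|[set x | 0 < f x]|%:R * p x0 = 1.
  move=> [f0 f1] fc; rewrite mulr_natl -sumr_const -f1.
  rewrite big_mkcond /=; apply: eq_bigr => x _; rewrite inE.
  by have := f0 x; rewrite le_eqVlt => /orP[/eqP <-|h]; [rewrite ltxx | rewrite h fc].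
have r_ex s : 0 < r s -> exists x y, [/\ s = x + y, 0 < p x & 0 < p y].
  by case/(law_gt0_ex m) => w <- /pos [[a b] _]; exists w.1, w.2.
have rc s : 0 < r s -> r s = p x0.
  by case/r_ex => x [y [-> px py]]; rewrite rE // (pE x x0).
have cA := card_cst p hp (fun x h => pE x x0 h px0).
have cB := card_cst r hr rc.
set A := [set x | 0 < p x] in cA; set H := [set x | 0 < r x] in cB.
have AH : #|A| = #|H|.
  apply/eqP; rewrite -(eqr_nat R); apply/eqP; apply: (mulIf (x := p x0)); last by rewrite cA cB.
  by rewrite gt_eqF.
(* The translate of the support of [p] lies in the support of [r], which has the same size. *)
have AHE : [set x + x0 | x in A] = H.
  apply/eqP; rewrite eqEcard card_imset; last exact: addIr.
  rewrite AH leqnn andbT; apply/fintype.subsetP => _ /imsetP[x + ->].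
  by rewrite !inE => px; rewrite rE.
have inH x : (x + x0 \in H) = (0 < p x).
  by rewrite -AHE (mem_imset _ _ (addIr x0)) inE.
have inA x : (x \in H) = (0 < p (x + x0)) by rewrite -inH -addrA addGG addr0.
exists H, x0; split.
- by rewrite -(addGG x0) inH.
- move=> x y; rewrite !inA => px py.
  have -> : x + y = (x + x0) + (y + x0) by char2 addGG [:: x; y; x0].
  by rewrite -inA inE rE.
- move=> x; rewrite inH; have := ge0 x; rewrite le_eqVlt => /orP[/eqP <-|h].
    by rewrite ltxx.
  rewrite h (pE x x0) //; apply: (mulfI (x := #|H|%:R)); last first.
    rewrite cB divff // pnatr_eq0; apply/eqP => e.
    by move: cB; rewrite e mul0r => /eqP; rewrite eq_sym oner_eq0.
  apply/eqP => e; by move: cB; rewrite e mul0r => /eqP; rewrite eq_sym oner_eq0.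
Qed.
End Subgroup.

(** * Existence of a minimizer *)

Section Minimizer.
Variable R : realType.

(** [ln] is 0 on nonpositive reals, so only the right of 0 needs an estimate: with [s] the square
    root of [y], the bound [- ln s < s^-1] gives [- (y * ln y) < 2 * s]. *)
Lemma continuous_xlnx : continuous (fun x : R => x * ln x).
Proof.
move=> x; case: (ltrgt0P x) => [x0|x0|->].
- by apply: cvgM; [exact: cvg_id | exact: continuous_ln].
- apply: (@near_cst_continuous _ _ 0); near=> y.
  by rewrite ln0 ?mulr0 // ltW //; near: y; exact: lt_nbhsl.
rewrite /continuous_at mul0r; apply/cvgr0Pnorm_lt => e e0.
have d0 : 0 < (e / 2) ^+ 2 by rewrite exprn_gt0 // divr_gt0.
near=> y.
have [y0|y0] := leP y 0; first by rewrite ln0 // mulr0 normr0.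
have y1 : y < 1 by near: y; exact: lt_nbhsl.
have yd : y < (e / 2) ^+ 2 by near: y; exact: lt_nbhsl.
pose s := Num.sqrt y; have s0 : 0 < s by rewrite sqrtr_gt0.
have ys : y = s ^+ 2 by rewrite sqr_sqrtr // ltW.
have ln_s : - ln s < s^-1 by rewrite -lnV ?posrE // ln_sublinear // invr_gt0.
rewrite ler0_norm; last by rewrite mulr_ge0_le0 ?(ltW y0) // ln_le0 // ltW.
have -> : - (y * ln y) = 2 * s * (s * - ln s) by rewrite ys lnXn // mulr2n; ring.
have se : s < e / 2.
  by rewrite -(@ltr_pXn2r _ 2) ?nnegrE ?ltW ?divr_gt0 // -ys.
have : s * - ln s < 1 by rewrite -(mulfV (lt0r_neq0 s0)) ltr_pM2l.
nra.
Unshelve. all: by end_near. Qed.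

Section Continuity.
Variables (V : topologicalType) (G : finZmodType).

Lemma continuous_sum (I : Type) (r : seq I) (P : pred I) (F : I -> V -> R) :
  (forall i, continuous (F i)) -> continuous (fun v => \sum_(i <- r | P i) F i v).
Proof.
move=> cF; elim: r => [|i r IH] v.
  under eq_fun do rewrite big_nil; exact: cvg_cst.
under eq_fun do rewrite big_cons; case: (P i); last exact: IH.
by apply: cvgD; [exact: cF | exact: IH].
Qed.

Lemma continuous_lent (p : V -> G -> R) :
  (forall g, continuous (p ^~ g)) -> continuous (fun v => lent (p v)).
Proof.
move=> cp; rewrite (_ : (fun v => _) = (fun v => - \sum_g p v g * ln (p v g))).
  move=> v; apply: cvgN; apply: continuous_sum => g {}v.
  exact: (continuous_comp (cp g v) (@continuous_xlnx _)).
apply/funext => v; rewrite /lent /ent; congr (- _); apply: eq_bigr => g _.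
by rewrite /law big_pred1_eq.
Qed.

Lemma continuous_conv (p q : V -> G -> R) :
  (forall g, continuous (p ^~ g)) -> (forall g, continuous (q ^~ g)) ->
  forall g, continuous (fun v => conv (p v) (q v) g).
Proof.
move=> cp cq g; apply: continuous_sum => w v.
by apply: cvgM; [exact: cp | exact: cq].
Qed.

Lemma continuous_rdist (p q : V -> G -> R) :
  (forall g, continuous (p ^~ g)) -> (forall g, continuous (q ^~ g)) ->
  continuous (fun v => rdist (p v) (q v)).
Proof.
move=> cp cq v; apply: cvgB; first apply: cvgB.
- exact: continuous_lent (continuous_conv cp cq) v.
- by apply: cvgM; [exact: continuous_lent cp v | exact: cvg_cst].
- by apply: cvgM; [exact: continuous_lent cq v | exact: cvg_cst].
Qed.

Lemma continuous_penalized_rdist (p0 q0 : G -> R) (eta : R) (p q : V -> G -> R) :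
  (forall g, continuous (p ^~ g)) -> (forall g, continuous (q ^~ g)) ->
  continuous (fun v => rdist (p v) (q v) + eta * (rdist p0 (p v) + rdist q0 (q v))).
Proof.
move=> cp cq v; have ccst (r : G -> R) g : continuous (fun _ : V => r g).
  exact: cst_continuous.
apply: cvgD; first exact: continuous_rdist cp cq v.
apply: cvgM; first exact: cvg_cst.
by apply: cvgD; [exact: (continuous_rdist (ccst p0) cp) | exact: (continuous_rdist (ccst q0) cq)].
Qed.
End Continuity.

Local Open Scope classical_set_scope.

(** A pair of laws is coded as a row vector indexed by [bool * G]. Such pairs form the closed part
    of the unit cube on which both halves sum to 1, and the extreme value theorem applies there. *)
Lemma exists_minimizer (G : finZmodType) (p0 q0 : G -> R) (eta : R) : prob p0 -> prob q0 ->
  exists p1 p2 : G -> R, [/\ prob p1, prob p2 & forall p q, prob p -> prob q ->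
    rdist p1 p2 + eta * (rdist p0 p1 + rdist q0 p2) <= rdist p q + eta * (rdist p0 p + rdist q0 q)].
Proof.
move=> hp0 hq0; pose I := (bool * G)%type.
pose coord b (v : 'rV[R]_#|{: I}|) (g : G) := v ord0 (enum_rank ((b, g) : I)).
pose mk (p q : G -> R) : 'rV[R]_#|{: I}| :=
  \row_i (if (enum_val i).1 then p (enum_val i).2 else q (enum_val i).2).
have mk1 p q : coord true (mk p q) = p.
  by apply/funext => g; rewrite /coord mxE enum_rankK.
have mk2 p q : coord false (mk p q) = q.
  by apply/funext => g; rewrite /coord mxE enum_rankK.
have ccoord b g : continuous (coord b ^~ g) by exact: coord_continuous.
pose tot b v := \sum_g coord b v g.
pose B := [set v : 'rV[R]_#|{: I}| | forall i, `[0, 1] (v ord0 i)].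
pose A := B `&`
  (tot true @^-1` [set x | x = 1] `&` tot false @^-1` [set x | x = 1]).
pose f v := rdist (coord true v) (coord false v) +
  eta * (rdist p0 (coord true v) + rdist q0 (coord false v)).
have probA v : A v -> prob (coord true v) /\ prob (coord false v).
  move=> [box [t1 t2]]; split; split=> // g.
    by have /= := box (enum_rank ((true, g) : I)); rewrite in_itv /= => /andP[].
  by have /= := box (enum_rank ((false, g) : I)); rewrite in_itv /= => /andP[].
have prob_le1 (p : G -> R) g : prob p -> 0 <= p g <= 1.
  move=> [p_ge0 <-]; rewrite p_ge0 (bigD1 g) //= lerDl; exact: sumr_ge0.
have mkA p q : prob p -> prob q -> A (mk p q).
  move=> hp hq; split=> [i|]; first by rewrite /= in_itv /= mxE; case: ifP => _; exact: prob_le1.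
  by split; rewrite /= /tot ?mk1 ?mk2; [case: hp | case: hq].
have ctot b : continuous (tot b) by apply: continuous_sum => g; exact: ccoord.
have cA : compact A.
  apply: (subclosed_compact (B := B)).
  - apply: closedI; last first.
      apply: closedI; apply: preimage_closed; try exact: closed_eq; by move=> ? _; exact: ctot.
    rewrite (_ : B =
      \bigcap_i ((fun v : 'rV[R]_#|{: I}| => v ord0 i) @^-1` `[0, 1])); last first.
      by apply/seteqP; split=> v /= h i => [_|]; exact: h.
    apply: closed_bigI => i _; apply: preimage_closed; last exact: itv_closed.
    by move=> ? _; exact: coord_continuous.
  - by apply: (@rV_compact R _ (fun=> `[0, 1])) => i; exact: segment_compact.
  - by move=> v [].
have cf : continuous f by exact: continuous_penalized_rdist (ccoord true) (ccoord false).
have A0 : A !=set0 by exists (mk p0 q0); exact: mkA.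
have [v /set_mem vA vmin] := EVT_min_rV A0 cA (continuous_subspaceT cf).
have [h1 h2] := probA _ vA.
exists (coord true v), (coord false v); split=> // p q hp hq.
by have := vmin (mk p q) (mem_set (mkA p q hp hq)); rewrite /f mk1 mk2.
Qed.

End Minimizer.

(** * Concentration of the graph on a coset *)

Section PFR.
Variables (R : realType) (G : finZmodType).
Hypothesis addGG : forall x : G, x + x = 0.

(** For a subgroup [H] in exponent two, [x + x0 \in H] says that [x] lies in the coset of [x0]. *)
Definition coset_unif (H : {set G}) (x0 x : G) : R :=
  if x + x0 \in H then #|H|%:R^-1 else 0.

(** Here 1004 is 1000 + 4: comparing the minimizer with [(p0, q0)] costs [1000 * rdist p0 q0], plus
    the self-distances of [p0] and [q0], each at most [2 * rdist p0 q0]. *)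
Lemma entropic_pfr (p0 q0 : G -> R) : prob p0 -> prob q0 ->
  exists (H : {set G}) (x0 : G), [/\ 0 \in H, {in H &, forall x y, x + y \in H},
    prob (coset_unif H x0) & rdist p0 (coset_unif H x0) <= 1004%:R * rdist p0 q0].
Proof.
move=> hp0 hq0; set eta : R := 1000%:R^-1.
have eta0 : 0 <= eta by rewrite invr_ge0 ler0n.
have [p1 [p2 [h1 h2 minp]]] := exists_minimizer eta hp0 hq0.
have d0 : rdist p1 p2 = 0.
  apply: (minimizer_rdist_eq0 addGG h1 h2) => p q hp hq; rewrite -/eta.
  have t1 := rdist_tri addGG hp0 h1 hp; have t2 := rdist_tri addGG hq0 h2 hq.
  have := minp p q hp hq.
  have : eta * (rdist p0 p + rdist q0 q) <=
      eta * (rdist p0 p1 + rdist q0 p2) + eta * (rdist p1 p + rdist p2 q).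
    by rewrite -mulrDr ler_wpM2l //; lra.
  lra.
have d11 : rdist p1 p1 = 0.
  apply/eqP; rewrite eq_le rdist_ge0 // andbT.
  by have := rdist_tri addGG h1 h2 h1; rewrite (rdistC p2) d0 addr0.
have [H [x0 [H0 HD p1E]]] := rdist_self_eq0 addGG h1 d11.
have uE : coset_unif H x0 = p1 by apply/funext => x; rewrite p1E.
exists H, x0; rewrite uE; split=> //.
have := minp p0 q0 hp0 hq0; rewrite d0 add0r /eta.
have t1 := rdist_tri addGG hp0 hq0 hp0; have t2 := rdist_tri addGG hq0 hp0 hq0.
have := rdist_ge0 addGG hq0 h2; rewrite (rdistC q0 p0) in t1 t2; lra.
Qed.

(** For independent [X] distributed as [p] and [Y] uniform on the coset, fixing [X + Y] confines [X]
    to the part of [A] in a translate of [H]. The largest such part bounds the entropy of [X] given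
    [X + Y], which is the mean of the two entropies minus the distance. *)
Lemma coset_concentration (p : G -> R) (A H : {set G}) (x0 : G) (d : R) :
  prob p -> (forall x, 0 < p x -> x \in A) -> prob (coset_unif H x0) ->
  rdist p (coset_unif H x0) <= d ->
  ln #|H|%:R <= lent p + 2 * d /\
  exists t, (0 < #|[set x in A | (x + t)%R \in H]|)%N /\
    lent p - 2 * d <= ln #|[set x in A | (x + t)%R \in H]|%:R.
Proof.
move=> hp pA hu du; set u := coset_unif H x0 in hu du.
have Hgt0 : (0 < #|H|)%N.
  rewrite lt0n; apply/eqP => /eqP; rewrite cards_eq0 => /eqP e.
  have := hu.2; rewrite big1 => [/eqP|x _]; first by rewrite eq_sym oner_eq0.
  by rewrite /u /coset_unif e inE.
have HR : (0 : R) < #|H|%:R by rewrite ltr0n.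
have Hu : lent u = ln #|H|%:R.
  rewrite /lent /ent (eq_bigr (fun x => u x * - ln #|H|%:R)).
    by rewrite -mulr_suml hu.2 mul1r opprK.
  move=> x _; rewrite /law big_pred1_eq /u /coset_unif; case: ifP => _; last by rewrite !mul0r.
  by rewrite lnV ?posrE.
have := rdist_ge addGG hp hu; rewrite ler_norml Hu => /andP[g1 g2].
split; first lra.
pose N y := [set x in A | x + (y + x0) \in H].
have m := prodm_prob hp hu; have i := indep_prodm hp hu.
have posw w : 0 < prodm p u w -> 0 < p w.1 /\ 0 < u w.2.
  move=> mw; have := law_gt0 m fst mw; have := law_gt0 m snd mw.
  by rewrite law_prodm1 // law_prodm2.
have inN w : 0 < prodm p u w -> w.1 \in N (w.1 + w.2).
  move=> /posw [pw uw]; rewrite inE pA //=.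
  have -> : w.1 + (w.1 + w.2 + x0) = w.2 + x0 by char2 addGG [:: w.1; w.2; x0].
  by move: uw; rewrite /u /coset_unif; case: ifP => //; rewrite ltxx.
have [y0 _ yE] : exists2 y, y \in [set: G] & forall y', (#|N y'| <= #|N y|)%N.
  exists [arg max_(y > 0 | true) #|N y|]; first by rewrite inE.
  by move=> y'; case: arg_maxnP => //= y _; apply.
have Ngt0 : (0 < #|N y0|)%N.
  have [w mw] : exists w, 0 < prodm p u w.
    apply/existsP; apply: contraT; rewrite negb_exists => /forallP none.
    have := m.2; rewrite big1 => [/eqP|w _]; first by rewrite eq_sym oner_eq0.
    by apply/eqP; rewrite eq_le m.1 andbT leNgt none.
  apply: leq_trans (yE (w.1 + w.2)); apply/card_gt0P; exists w.1; exact: inN.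
exists (y0 + x0); split=> //.
have le b : #|N b|%:R <= #|N y0|%:R :> R by rewrite ler_nat.
have N0R : (0 : R) < #|N y0|%:R by rewrite ltr0n.
have := ent_cond_card m (X := fst) (Y := fun w => w.1 + w.2) inN le N0R.
have -> : ent (prodm p u) (fun w => (w.1, w.1 + w.2)) = lent p + lent u.
  rewrite (@ent_determined _ _ _ m _ _ _ (fun w => (w.1, w.2))
    (fun t => (t.1, t.1 + t.2)) (fun t => (t.1, t.1 + t.2))) //=; last first.
    by move=> w _; congr (_, _); char2 addGG [:: w.1; w.2].
  by rewrite (indep_ent m i) -!lent_law law_prodm1 // law_prodm2.
rewrite -(lent_law _ (fun w : G * G => w.1 + w.2)) -/(conv p u) Hu.
have g3 : lent p - ln #|H|%:R <= 2 * d by lra.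
move: du; rewrite /rdist Hu -/(N y0); lra.
Qed.

Lemma weighted_mean_le (C : finType) (p v : C -> R) (M : R) : prob p ->
  \sum_c p c * v c <= M -> exists2 c, 0 < p c & v c <= M.
Proof.
move=> [p0 p1] le.
have [c /andP[pc vc]|none] := pickP (fun c => (0 < p c) && (v c <= M)); first by exists c.
suff : M < \sum_c p c * v c by rewrite ltNge le.
have [c0 pc0] : exists c, 0 < p c.
  apply/existsP; apply: contraT; rewrite negb_exists => /forallP no.
  have := p1; rewrite big1 => [/eqP|c _]; first by rewrite eq_sym oner_eq0.
  by apply/eqP; rewrite eq_le p0 andbT leNgt no.
have gt c : 0 < p c -> M < v c by move=> pc; have := none c; rewrite pc ltNge => /= ->.
rewrite -[M]mul1r -p1 mulr_suml (bigD1 c0) //= [ltRHS](bigD1 c0) //=.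
apply: ltr_leD; first by rewrite ltr_pM2l // gt.
apply: ler_sum => c _; have := p0 c; rewrite le_eqVlt => /orP[/eqP <-|pc].
  by rewrite !mul0r.
by rewrite ler_pM2l // ltW // gt.
Qed.

(* The laws of A and B given a typical value of A + B. *)
Lemma bsg_fibre (O : finType) (mu : O -> R) (A B : O -> G) (Gam : {set G}) (k : R) :
  prob mu -> (forall w, 0 < mu w -> [/\ A w \in Gam, B w \in Gam & A w + B w \in Gam]) ->
  2 * ln #|Gam|%:R - k <= ent mu (fun w => (A w, B w)) ->
  exists p q : G -> R, [/\ prob p, prob q, (forall x, 0 < p x -> x \in Gam) &
    rdist p q + (ln #|Gam|%:R - lent p) <= 4 * k].
Proof.
move=> hm hG; set L := ln _ => hAB.
have Ggt0 : (0 < #|Gam|)%N.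
  have [w mw _] := weighted_mean_le hm (lexx (\sum_w mu w * 0)).
  by apply/card_gt0P; exists (A w); case: (hG w mw).
have eA : ent mu A <= L by apply: ent_card => // w /hG [].
have eB : ent mu B <= L by apply: ent_card => // w /hG [].
have eZ : ent mu (fun w => A w + B w) <= L by apply: ent_card => // w /hG [].
have tt1 (X : finType) (F : O -> X) : ent mu (fun w => (F w, tt)) = ent mu F.
  exact: (ent_determined hm (f := fun t => t.1) (g := fun t => (t, tt))).
have := bsg_ent addGG A B (fun=> tt) hm.
rewrite /= !tt1 ent_cst //.
set Z := fun w => (A w + B w, tt); set nu := cond_copies mu Z => bsg.
have hn : prob nu by exact: cond_copies_prob.
have i : cindep nu (fun w => A w.1) (fun w => B w.2) (fun w => Z w.1) by exact: cindep_copies.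
have Zhn w : 0 < nu w -> Z w.2 = Z w.1 by move/cond_copies_eq.
have sumE : \sum_c law nu (fun w => Z w.1) c *
    (rdist (law (cond nu (fun w => Z w.1) c) (fun w => A w.1))
          (law (cond nu (fun w => Z w.1) c) (fun w => B w.2)) +
     (L - lent (law (cond nu (fun w => Z w.1) c) (fun w => A w.1)))) =
   ent nu (fun w => (A w.1 + B w.2, Z w.1)) - ent nu (fun w => Z w.1)
   - (ent nu (fun w => (A w.1, Z w.1)) - ent nu (fun w => Z w.1)) / 2
   - (ent nu (fun w => (B w.2, Z w.1)) - ent nu (fun w => Z w.1)) / 2
   + (L - (ent nu (fun w => (A w.1, Z w.1)) - ent nu (fun w => Z w.1))).
  rewrite !ent_cond //.
  have -> : L = \sum_c law nu (fun w => Z w.1) c * L.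
    by rewrite -mulr_suml (law_prob hn _).2 mul1r.
  rewrite !mulr_suml -!sumrB -big_split /=; apply: eq_bigr => c _.
  have := law_ge0 hn (fun w => Z w.1) c; rewrite le_eqVlt => /orP[/eqP <-|h].
    by rewrite !mul0r; lra.
  rewrite -mulr_suml (law_prob hn _).2 mul1r.
  rewrite /rdist (lent_conv (cindep_cond i h)) (lent_law _ (fun w => A w.1)).
  rewrite (lent_law _ (fun w => B w.2)).
  ring.
(* [A], [B] and [A + B] have entropy at most [L], and [(A, B)] at least [2 * L - k]; the mean is
   thus at most [2 * L + 2 * L - 4 * (2 * L - k) + 3 * L + L = 4 * k]. *)
have [|c h] := weighted_mean_le (M := 4 * k) (law_prob hn (fun w => Z w.1)) _ (v := fun c =>
    (rdist (law (cond nu (fun w => Z w.1) c) (fun w => A w.1))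
          (law (cond nu (fun w => Z w.1) c) (fun w => B w.2)) +
     (L - lent (law (cond nu (fun w => Z w.1) c) (fun w => A w.1))))).
  rewrite sumE.
  rewrite -(ent_pair1 (fun w => B w.2) hn Zhn) (ent_copies1 hm Z Z).
  have e1 := ent_copies1 hm Z (fun w => (A w, Z w)).
  have e2 := ent_copies2 hm Z (fun w => (B w, Z w)).
  rewrite /= in e1 e2; rewrite e1 e2.
  have -> : ent mu (fun w => (A w, Z w)) = ent mu (fun w => (A w, B w)).
    apply: (ent_determined hm (f := fun t => (t.1, t.1 + t.2.1))
      (g := fun t => (t.1, (t.1 + t.2, tt)))) => // w _ /=.
    by congr (_, _); char2 addGG [:: A w; B w].
  have -> : ent mu (fun w => (B w, Z w)) = ent mu (fun w => (A w, B w)).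
    apply: (ent_determined hm (f := fun t => (t.1 + t.2.1, t.1))
      (g := fun t => (t.2, (t.1 + t.2, tt)))) => // w _ /=.
    by congr (_, _); char2 addGG [:: A w; B w].
  have eZ' : ent mu Z = ent mu (fun w => A w + B w) by exact: tt1.
  rewrite eZ' in bsg *; lra.
have hc := cond_prob hn h.
exists (law (cond nu (fun w => Z w.1) c) (fun w => A w.1)).
exists (law (cond nu (fun w => Z w.1) c) (fun w => B w.2)); split=> //; try exact: law_prob.
move=> x /(law_gt0_ex hc) [w <-].
have nw : cond nu (fun w => Z w.1) c w > 0 -> 0 < nu w.
  rewrite /cond; case: ifP => _; last by rewrite ltxx.
  by rewrite pmulr_lgt0 // invr_gt0.
move/nw => {}nw; have := law_gt0 hn (fun w => w.1) nw.
by rewrite (law_copies_fst hm Z id) => /(law_gt0_ex hm) [v ->] /hG [].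
Qed.

End PFR.

(** * From subgroups to linear maps *)

(** Joins the finite and additive structures of a product, so that the results on [finZmodType]
    apply to the space containing the graph. *)
HB.instance Definition _ (U V : finZmodType) := Finite.on (U * V)%type.

Lemma F2_cases (a : 'F_2) : a = 0 \/ a = 1.
Proof. by case: a => [[|[|]]] //= h; [left|right]; apply: val_inj. Qed.

Lemma rV_F2_addxx n (x : 'rV['F_2]_n) : x + x = 0.
Proof. by apply/rowP => i; rewrite !mxE; case: (F2_cases (x 0 i)) => ->; apply: val_inj. Qed.

Lemma pair_F2_addxx m n (x : 'rV['F_2]_m * 'rV['F_2]_n) : x + x = 0.
Proof. by case: x => a b; congr (_, _); exact: rV_F2_addxx. Qed.

(** The rows of [L] and [L'] list the coordinates of the elements of [H]. Over the field with two
    elements every combination of them stays in [H], and [pinvmx L] selects linearly a combination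
    with first coordinate [x]. *)
Lemma subgroup_linear_section m n (H : {set 'rV['F_2]_m * 'rV['F_2]_n}) :
  0 \in H -> {in H &, forall x y, x + y \in H} ->
  exists M : 'M['F_2]_(m, n), forall x y, (x, y) \in H -> (x, x *m M) \in H.
Proof.
move=> H0 HD.
pose L : 'M['F_2]_(#|H|, m) := \matrix_(i < #|H|) (enum_val i).1.
pose L' : 'M['F_2]_(#|H|, n) := \matrix_(i < #|H|) (enum_val i).2.
have span (u : 'rV['F_2]_#|H|) : (u *m L, u *m L') \in H.
  rewrite !mulmx_sum_row; elim/big_rec2: _ => [|i a b _ abH]; first exact: H0.
  rewrite !rowK; case: (F2_cases (u 0 i)) => ->; first by rewrite !scale0r !add0r.
  rewrite !scale1r; apply: (HD (_, _) (b, a)) => //.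
  by rewrite -surjective_pairing enum_valP.
exists (pinvmx L *m L') => x y xyH; rewrite mulmxA.
rewrite -{1}(@mulmxKpV _ _ _ _ x L) //.
have -> : x = row (enum_rank_in xyH (x, y)) L by rewrite rowK enum_rankK_in.
exact: row_sub.
Qed.

(** Adding a functional [e] with [x *m e = 1] exchanges the functionals of value 0 at [x] with those
    of value 1. *)
Lemma F2_half_functionals m (x : 'rV['F_2]_m) : x != 0 ->
  (#|[set l : 'cV['F_2]_m | (x *m l) 0%R 0%R == 1%R]| * 2 = #|{: 'cV['F_2]_m}|)%N.
Proof.
move=> x0.
have [i xi] : exists i, x 0 i = 1.
  have /existsP[i xi] : [exists i, x 0 i != 0].
    apply: contraT; rewrite negb_exists => /forallP h.
    move: x0; rewrite -[_ != _]negbK; case/negP; rewrite negbK; apply/eqP/rowP => i.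
    by have := h i; rewrite negbK mxE => /eqP.
  by exists i; case: (F2_cases (x 0 i)) => // e; rewrite e eqxx in xi.
pose e : 'cV['F_2]_m := delta_mx i 0.
have xe : (x *m e) 0 0 = 1 by rewrite -colE mxE.
pose A (a : 'F_2) := [set l : 'cV['F_2]_m | (x *m l) 0 0 == a].
have A01 : A 0 = ~: A 1.
  apply/setP => l; rewrite !inE; by case: (F2_cases ((x *m l) 0 0)) => ->.
have addE (u v : 'M['F_2]_1) : (u + v) 0 0 = u 0 0 + v 0 0 by rewrite [LHS]mxE.
have A10 : [set l + e | l in A 1] = A 0.
  apply/setP => l; apply/imsetP/idP => [[l' + ->]|].
    rewrite !inE mulmxDr addE xe => /eqP ->; apply/eqP; exact: val_inj.
  rewrite inE => /eqP h; exists (l + e); last first.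
    rewrite -addrA (_ : e + e = 0) ?addr0 //.
    by apply: trmx_inj; rewrite linearD rV_F2_addxx linear0.
  by rewrite inE mulmxDr addE xe h add0r.
have : (#|A 1%R| + #|~: A 1%R|)%N = #|{: 'cV['F_2]_m}| by rewrite cardsC.
by rewrite -A01 -A10 card_imset ?muln2 ?addnn //; exact: addIr.
Qed.

(* Averaging over all functionals: each nonzero x satisfies x *m l = 1 for half of the l. *)
Lemma exists_functional m (T : {set 'rV['F_2]_m}) : 0 \notin T ->
  exists l : 'cV['F_2]_m, (#|T| <= 2 * #|[set x in T | (x *m l) 0%R 0%R == 1%R]|)%N.
Proof.
move=> T0; apply/existsP; apply: contraT; rewrite negb_exists => /forallP h.
have {}h (l : 'cV['F_2]_m) : (2 * #|[set x in T | (x *m l) 0%R 0%R == 1%R]| < #|T|)%N.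
  by rewrite ltnNge; apply: h.
have : (\sum_(l : 'cV['F_2]_m) 2 * #|[set x in T | (x *m l) 0%R 0%R == 1%R]| <
        \sum_(l : 'cV['F_2]_m) #|T|)%N.
  rewrite (bigD1 0) //= [X in (_ < X)%N](bigD1 0) //=.
  rewrite -addSn; apply: leq_add; first exact: h.
  by apply: leq_sum => l _; apply: ltnW; exact: h.
rewrite sum_nat_const -big_distrr /=.
have -> : (\sum_(l : 'cV['F_2]_m) #|[set x in T | (x *m l) 0%R 0%R == 1%R]| =
  \sum_(x in T) #|[set l : 'cV['F_2]_m | (x *m l) 0%R 0%R == 1%R]|)%N.
  under eq_bigr => l _ do rewrite -sum1_card big_mkcond /=.
  rewrite exchange_big /=; apply: eq_bigr => l _.
  rewrite -sum1_card big_mkcond [RHS]big_mkcond; apply: eq_bigr => x _.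
  by rewrite !inE; case: (x \in T).
rewrite big_distrr /= (eq_bigr (fun=> #|{: 'cV['F_2]_m}|)).
  by rewrite sum_nat_const mulnC ltnn.
move=> x xT; rewrite mulnC F2_half_functionals //.
by apply: contraNneq T0 => <-.
Qed.

(** Where [x *m l = 1], the constant [c] equals [x *m (l *m c)]. One factor 2 pays for removing 0
    from [T], the other for the choice of [l]. *)
Lemma affine_to_linear m n (f : 'rV['F_2]_m -> 'rV['F_2]_n) (M : 'M['F_2]_(m, n))
    (c : 'rV['F_2]_n) (T : {set 'rV['F_2]_m}) : (0 < m)%N ->
  (forall x, x \in T -> f x = x *m M + c) ->
  exists M' : 'M['F_2]_(m, n), (#|T| <= 4 * #|[set x | f x == x *m M']|)%N.
Proof.
move=> m0 fT.
(* If [T] is contained in [{0}], removing 0 leaves nothing; agreement at a single nonzero vector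
   then suffices, and one exists since [0 < m]. *)
have [T1|T1] := leqP #|T| 1.
  pose i0 := Ordinal m0; pose x1 : 'rV['F_2]_m := delta_mx 0 i0.
  pose l : 'cV['F_2]_m := delta_mx i0 0.
  exists (l *m f x1); apply: leq_trans T1 _; rewrite muln_gt0 /=.
  apply/card_gt0P; exists x1; rewrite inE mulmxA mul_delta_mx_cond eqxx mulr1n.
  by rewrite (_ : delta_mx _ _ = 1%:M) ?mul1mx //; apply/matrixP => i j; rewrite !ord1 !mxE.
pose T' := T :\ 0.
have T'0 : 0 \notin T' by rewrite !inE eqxx.
have [l hl] := exists_functional T'0.
exists (M + l *m c).
have T'T : (#|T| <= 2 * #|T'|)%N.
  rewrite (cardsD1 0 T) -/T'; move: T1; rewrite (cardsD1 0 T) -/T'.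
  by case: (0 \in T) => /=; case: #|T'| => // k _; rewrite mul2n -addnn // leq_add2r.
apply: leq_trans T'T _; rewrite -[4%N]/(2 * 2)%N -mulnA leq_mul2l /=.
apply: leq_trans hl _; rewrite leq_mul2l /=; apply: subset_leq_card.
apply/fintype.subsetP => x; rewrite !inE => /andP[/andP[_ xT] /eqP xl].
rewrite fT // mulmxDr mulmxA; apply/eqP; congr (_ + _).
have -> : x *m l = 1%:M.
  by apply/matrixP => i j; rewrite !ord1 xl mxE.
by rewrite mul1mx.
Qed.

(* Pigeonhole over the fibre [F0] of H above 0, whose size is at most [#|H| / #|D|]. *)
Lemma coset_graph_linear m n (f : 'rV['F_2]_m -> 'rV['F_2]_n)
    (H : {set 'rV['F_2]_m * 'rV['F_2]_n}) t : (0 < m)%N ->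
  0 \in H -> {in H &, forall x y, x + y \in H} ->
  let D := [set x | (x, f x) + t \in H] in
  exists M : 'M['F_2]_(m, n), (#|D| ^ 2 <= 4 * #|[set x | f x == x *m M]| * #|H|)%N.
Proof.
move=> m0 H0 HD /=; set D := [set x | _]; case: t @D => t1 t2 D.
have [M HM] := subgroup_linear_section H0 HD.
pose F0 := [set y | (0, y) \in H].
have inD x : x \in D -> (x + t1, f x + t2) \in H by rewrite inE.
(* The discrepancy between [f] and the linear section, up to the translation by [t]; it takes values
   in [F0]. *)
pose h x := f x + t2 + (x + t1) *m M.
have hF0 x : x \in D -> h x \in F0.
  move=> /inD xD; rewrite inE; have := HD _ _ xD (HM _ _ xD).
  by rewrite /= (_ : (_, _) + (_, _) = (x + t1 + (x + t1), h x)) // rV_F2_addxx.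
have DF : (#|D| * #|F0| <= #|H|)%N.
  (* Translating the fibre [F0] to each graph point over [D] embeds the product of [D] and [F0] into
     [H]. *)
  pose phi (z : 'rV['F_2]_m * 'rV['F_2]_n) := (z.1 + t1, f z.1 + t2 + z.2).
  rewrite -cardsX -(card_imset (f := phi)); last first.
    by move=> [x y] [x' y'] [/addIr ->] /addrI ->.
  apply: subset_leq_card; apply/fintype.subsetP => _ /imsetP[[x y] /setXP[xD yF] ->].
  rewrite inE in yF; rewrite (_ : phi _ = (x + t1, f x + t2) + (0, y)).
    exact: HD (inD _ xD) yF.
  by rewrite /phi; congr (_, _); rewrite /= ?addr0.
pose T c := [set x in D | h x == c].
have sumT : #|D| = (\sum_(c in F0) #|T c|)%N.
  rewrite -[LHS]sum1_card (partition_big h (mem F0) hF0) /=.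
  by apply: eq_bigr => c _; rewrite -[RHS]sum1_card; apply: eq_bigl => x; rewrite [RHS]inE.
have [D0|/card_gt0P[x0 x0D]] := posnP #|D|; first by exists 0; rewrite D0.
have [c cF cT] : exists2 c, c \in F0 & forall c', c' \in F0 -> (#|T c'| <= #|T c|)%N.
  have c0F := hF0 _ x0D; exists [arg max_(c > h x0 in F0) #|T c|]%N.
    by case: arg_maxnP.
  by case: arg_maxnP => // c _ le c' /le.
have DT : (#|D| <= #|F0| * #|T c|)%N by rewrite sumT -sum_nat_const; exact: leq_sum.
have fT x : x \in T c -> f x = x *m M + (t2 + t1 *m M + c).
  rewrite inE => /andP[_ /eqP <-]; rewrite /h mulmxDl.
  have e (a b u v : 'rV['F_2]_n) : a = u + (b + v + (a + b + (u + v))).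
    by char2 (@rV_F2_addxx n) [:: a; b; u; v].
  exact: e.
have [M' TM'] := affine_to_linear m0 fT.
exists M'; rewrite expnS expn1.
apply: leq_trans (leq_mul (leqnn _) DT) _; rewrite mulnA mulnC.
by apply: leq_mul.
Qed.

(** * Assembly of the quantitative bounds *)

Theorem corollary1p5 (R : realType) :
  exists C4 c : R, [/\ 0 < C4, 0 < c &
    forall (m n : nat) (K : R) (f : 'rV['F_2]_m -> 'rV['F_2]_n),
      (0 < m)%N -> (0 < n)%N -> 0 < K ->
      1 / K <= unif_prob R (fun xy : 'rV['F_2]_m * 'rV['F_2]_m =>
                              f (xy.1 + xy.2) == f xy.1 + f xy.2) ->
      exists g : {additive 'rV['F_2]_m -> 'rV['F_2]_n},
        c * K `^ (- C4) <= unif_prob R (fun x : 'rV['F_2]_m => f x == g x)].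
Proof.
(* With [k = ln K], the distance to the coset law is at most [1004 * 4 * k = 4016 * k]. Hence
   [ln #|H|] is at most [ln N + 8032 * k] and [ln #|D|] at least [ln N - 8036 * k]; the exponent is
   2 * 8036 + 8032, and 1/4 comes from [coset_graph_linear]. *)
exists 24104%:R, (4%:R^-1); split; rewrite ?ltr0n ?invr_gt0 // => m n K f m0 _ K0.
pose V := 'rV['F_2]_m; pose N := #|{: V}|.
have N0 : (0 < N)%N by apply/card_gt0P; exists 0.
have NR : (0 : R) < N%:R by rewrite ltr0n.
set E := [set xy : V * V | f (xy.1 + xy.2) == f xy.1 + f xy.2].
rewrite /unif_prob -/E card_prod natrM -/N => hE.
pose k := ln K.
have E0 : (0 < #|E|)%N.
  rewrite lt0n; apply/eqP => e; move: hE; rewrite e mul0r leNgt.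
  by rewrite divr_gt0.
have ER : (0 : R) < #|E|%:R by rewrite ltr0n.
have lnE : 2 * ln N%:R - k <= ln (#|E|%:R : R).
  have : ln (1 / K) <= ln (#|E|%:R / (N%:R * N%:R)).
    by rewrite ler_ln ?posrE ?divr_gt0 ?mulr_gt0.
  rewrite !ln_div ?posrE ?mulr_gt0 // ln1 lnM ?posrE // -/k; lra.
have k0 : 0 <= k.
  have : ln (#|E|%:R : R) <= ln (N%:R * N%:R).
    rewrite ler_ln ?posrE ?mulr_gt0 // -natrM ler_nat /N -card_prod; exact: max_card.
  rewrite lnM ?posrE //; lra.
pose mu (w : V * V) : R := if w \in E then #|E|%:R^-1 else 0.
have hmu : prob mu.
  split=> [w|]; first by rewrite /mu; case: ifP => // _; rewrite invr_ge0 ltW.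
  rewrite /mu -big_mkcond /= sumr_const -[LHS]mulr_natl mulfV //; exact: lt0r_neq0.
have muE w : 0 < mu w -> w \in E by rewrite /mu; case: ifP => //; rewrite ltxx.
pose G := (V * 'rV['F_2]_n)%type.
pose Gam : {set G} := [set (x, f x) | x : V].
have GamN : #|Gam| = N by rewrite card_imset // => x y [].
pose A (w : V * V) : G := (w.1, f w.1); pose B (w : V * V) : G := (w.2, f w.2).
have inG x : (x, f x) \in Gam by apply/imsetP; exists x.
have entAB : ent mu (fun w => (A w, B w)) = ln #|E|%:R.
  rewrite (@ent_determined _ _ _ hmu _ _ _ id (fun t => (t.1.1, t.2.1))
    (fun t => (A t, B t))) //; last by case.
  rewrite /ent (eq_mu_sum hmu (G := fun w => - ln #|E|%:R)).
    by rewrite -mulr_suml hmu.2 mul1r opprK.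
  move=> w /muE wE; rewrite /law big_pred1_eq /mu wE lnV //.
have inGam w : 0 < mu w -> [/\ A w \in Gam, B w \in Gam & A w + B w \in Gam].
  move=> /muE; rewrite inE => /eqP e; split; try exact: inG.
  by rewrite (_ : A w + B w = (w.1 + w.2, f (w.1 + w.2))) // e.
have hent : 2 * ln #|Gam|%:R - k <= ent mu (fun w => (A w, B w)) by rewrite entAB GamN.
have [p [q [hp hq pG pq]]] := bsg_fibre (@pair_F2_addxx m n) hmu inGam hent.
have [H [x0 [H0 HD hu du]]] := entropic_pfr (@pair_F2_addxx m n) hp hq.
have d0 := rdist_ge0 (@pair_F2_addxx m n) hp hq.
rewrite GamN in pq.
have pL : lent p <= ln N%:R by rewrite -GamN; apply: ent_card => //; rewrite GamN.
have d4016 : rdist p (coset_unif R H x0) <= 4016%:R * k by lra.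
have [lnH [t [tgt0 lnt]]] := coset_concentration (@pair_F2_addxx m n) hp pG hu d4016.
have [M] := coset_graph_linear f t m0 H0 HD.
set D := [set x | _]; set S := [set x | _] => cDSH.
(* Points of the graph in the coset are counted by their first coordinates. *)
have DE : [set x in Gam | x + t \in H] = [set (x, f x) | x in D].
  apply/setP => y; rewrite inE; apply/andP/imsetP => [[/imsetP[x _ ->] xH]|[x + ->]].
    by exists x => //; rewrite inE.
  by rewrite inE.
rewrite DE card_imset in tgt0 lnt; last by move=> x y [].
have SH0 : (0 < 4 * #|S| * #|H|)%N by apply: leq_trans cDSH; rewrite expn_gt0 tgt0.
have [S0 Hgt0] : (0 < #|S|)%N /\ (0 < #|H|)%N.
  by move: SH0; rewrite !muln_gt0 => /andP[/andP[_ ->] ->].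
have : ln (#|D| ^ 2)%:R <= ln (4 * #|S| * #|H|)%:R :> R.
  by rewrite ler_ln ?posrE ?ltr0n ?ler_nat // expn_gt0 tgt0.
rewrite natrX !natrM !lnM ?posrE ?mulr_gt0 ?ltr0n // => lnS.
exists (mulmxr M); rewrite -/N -/S.
(* Both sides are positive, so the claim becomes linear after taking logarithms. *)
rewrite -ler_ln ?posrE ?divr_gt0 ?mulr_gt0 ?powR_gt0 ?invr_gt0 ?ltr0n //.
rewrite lnM ?posrE ?powR_gt0 ?invr_gt0 ?ltr0n // ln_powR lnV ?posrE ?ltr0n //.
rewrite ln_div ?posrE ?ltr0n // -/k.
lra.
Qed.
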